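(* Let $P$ be an arbitrary set, let $\mathcal{M}_c\mathcal{S}^{co}$ be the category of the symmetric monoidal comonad freely generated by $P$ as set of generating objects, and let $\mathit{Rel}$ be the category of all binary relations between finite ordinals. Then the functor $G:\mathcal{M}_c\mathcal{S}^{co}\to\mathit{Rel}$ defined in the context is faithful; i.e. for all objects $A,B$ and all arrows $f,g:A\to B$ of $\mathcal{M}_c\mathcal{S}^{co}$, if $Gf=Gg$, then $f=g$.
   Context: A symmetric monoidal category has a bifunctor $\otimes$, a unit object $I$ and natural isomorphisms $a_{A,B,C}:(A\otimes B)\otimes C\to A\otimes(B\otimes C)$, $l_A:I\otimes A\to A$, $r_A:A\otimes I\to A$, $c_{A,B}:A\otimes B\to B\otimes A$ satisfying the usual coherence conditions (with $c_{B,A}\circ c_{A,B}=\mathbf 1_{A\otimes B}$). $\mathbf 1_A$ denotes the identity arrow of $A$. A symmetric monoidal comonad in a symmetric monoidal category is a comonad $\langle L,\varepsilon,\delta\rangle$ (with $\varepsilon_A:LA\to A$, $\delta_A:LA\to LLA$) together with a natural transformation with components $\psi_{A,B}:LA\otimes LB\to L(A\otimes B)$ and an arrow $\psi_0:I\to LI$ such that - $La_{A,B,C}\circ\psi_{A\otimes B,C}\circ(\psi_{A,B}\otimes\mathbf 1_{LC})=\psi_{A,B\otimes C}\circ(\mathbf 1_{LA}\otimes\psi_{B,C})\circ a_{LA,LB,LC}$, - $Ll_A\circ\psi_{I,A}\circ(\psi_0\otimes\mathbf 1_{LA})=l_{LA}$ and $Lr_A\circ\psi_{A,I}\circ(\mathbf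 1_{LA}\otimes\psi_0)=r_{LA}$, - $Lc_{A,B}\circ\psi_{A,B}=\psi_{B,A}\circ c_{LA,LB}$, - $\varepsilon_{A\otimes B}\circ\psi_{A,B}=\varepsilon_A\otimes\varepsilon_B$, - $\delta_{A\otimes B}\circ\psi_{A,B}=L\psi_{A,B}\circ\psi_{LA,LB}\circ(\delta_A\otimes\delta_B)$, - $\varepsilon_I\circ\psi_0=\mathbf 1_I$ and $\delta_I\circ\psi_0=L\psi_0\circ\psi_0$. $\mathcal{M}_c\mathcal{S}^{co}$ is the free such structure on $P$: its objects are the formal expressions built from elements of $P$ (propositional letters) and $I$ by $\otimes$ and $L$; its arrows are arrow terms built from identities, $a,a^{-1},l,l^{-1},r,r^{-1},c,\varepsilon,\delta,\psi,\psi_0$ by $\circ$, $\otimes$ and $L$, modulo the congruence generated by the equations of categories, functoriality, naturality, symmetric monoidal categories, comonads, and the equations above. $\mathit{Rel}$ has as objects the finite ordinals $n=\{0,\dots,n-1\}$ and as arrows $n\to m$ all relations $R\subseteq n\times m$, with the usual composition of relations. The functor $G$: $GA$ is the number of occurrences of propositional letters in $A$ plus the number of occurrences of $L$ in $A$ (occurrences of $I$ are not counted); the elements $0,\dots,GA-1$ of $GA$ correspond to these occurrences counted from right to left in $A$. On arrow terms: $G$ of an identity and of $a_{A,B,C}$, $l_A$, $r_A$ and their inverses is the identity relation; $Gc_{A,B}$ is the bijection sending every occurrence in $A$, respectively $B$, in the source $A\otimes B$ to the corresponding occurrence in $A$, respectively $B$, in the target $B\otimes A$; $G\psi_{A,B}$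 relates both the occurrence of $L$ in front of $A$ and the occurrence of $L$ in front of $B$ in the source $LA\otimes LB$ to the outermost occurrence of $L$ in the target $L(A\otimes B)$, and relates every counted occurrence inside $A$, respectively inside $B$, to the corresponding occurrence inside $A$, respectively $B$ (and nothing else is related); $G\psi_0$ is the empty relation from $0=\emptyset$ to $1=\{\emptyset\}$; $G\varepsilon_A\subseteq(GA+1)\times GA$ is $\{(i,i)\mid i<GA\}$; $G\delta_A\subseteq(GA+1)\times(GA+2)$ is $\{(i,i)\mid i\le GA\}\cup\{(GA,GA+1)\}$; $G(f\otimes g)$ is the juxtaposition of $Gf$ (on the left, i.e. on the larger elements) and $Gg$ (on the right, i.e. on the smaller elements); $GLf$ extends $Gf$ by relating the new leftmost (greatest) element of the source to the new leftmost (greatest) element of the target; $G(g\circ f)=Gg\circ Gf$. *)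

(* Defs.v *)
From mathcomp Require Import all_boot.
From mathcomp Require Import zify.

Set Implicit Arguments.
Unset Strict Implicit.
Unset Printing Implicit Defensive.

Declare Scope obj_scope.
Delimit Scope obj_scope with obj.
Declare Scope arr_scope.
Delimit Scope arr_scope with arr.

Inductive obj (P : Type) : Type :=
| Letter (p : P)
| Unit
| Tensor (A B : obj P)
| Ell (A : obj P).
Arguments Unit {P}.
Bind Scope obj_scope with obj.

Notation "A ⊗ B" := (Tensor A B) (at level 40, left associativity) : obj_scope.

(* Arrow terms of type [A -> B]; the arrows of the free category are these
   terms modulo the congruence [eqarr] below. *)
Inductive arr (P : Type) : obj P -> obj P -> Type :=
| Id (A : obj P) : arr A A
| Comp (A B C : obj P) (g : arr B C) (f : arr A B) : arr A C
| TensorA (A B A' B' : obj P) (f : arr A A') (g : arr B B') :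
    arr (A ⊗ B) (A' ⊗ B')
| EllA (A B : obj P) (f : arr A B) : arr (Ell A) (Ell B)
| assoc (A B C : obj P) : arr ((A ⊗ B) ⊗ C) (A ⊗ (B ⊗ C))
| assocV (A B C : obj P) : arr (A ⊗ (B ⊗ C)) ((A ⊗ B) ⊗ C)
| lunit (A : obj P) : arr (Unit ⊗ A) A
| lunitV (A : obj P) : arr A (Unit ⊗ A)
| runit (A : obj P) : arr (A ⊗ Unit) A
| runitV (A : obj P) : arr A (A ⊗ Unit)
| symm (A B : obj P) : arr (A ⊗ B) (B ⊗ A)
| eps (A : obj P) : arr (Ell A) A
| delta (A : obj P) : arr (Ell A) (Ell (Ell A))
| psi (A B : obj P) : arr (Ell A ⊗ Ell B) (Ell (A ⊗ B))
| psi0 : arr Unit (Ell Unit).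
Arguments psi0 {P}.
Bind Scope arr_scope with arr.

Notation "g ∘ f" := (Comp g f) (at level 45, left associativity) : arr_scope.
Notation "f ⊗ g" := (TensorA f g) (at level 40, left associativity) : arr_scope.

Reserved Notation "f ≡ g" (at level 70, no associativity).

(* Equality of arrows in the free symmetric monoidal comonad.  Naturality of
   the inverses of [assoc], [lunit] and [runit] is derivable, and is therefore
   not listed. *)
Inductive eqarr (P : Type) : forall A B : obj P, arr A B -> arr A B -> Prop :=
(* equivalence and congruence *)
| eqarr_refl A B (f : arr A B) : f ≡ f
| eqarr_sym A B (f g : arr A B) : f ≡ g -> g ≡ f
| eqarr_trans A B (f g h : arr A B) : f ≡ g -> g ≡ h -> f ≡ h
| eqarr_Comp A B C (g g' : arr B C) (f f' : arr A B) :
    g ≡ g' -> f ≡ f' -> g ∘ f ≡ g' ∘ f'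
| eqarr_TensorA A B A' B' (f f' : arr A A') (g g' : arr B B') :
    f ≡ f' -> g ≡ g' -> f ⊗ g ≡ f' ⊗ g'
| eqarr_EllA A B (f f' : arr A B) : f ≡ f' -> EllA f ≡ EllA f'
(* category *)
| Comp1a A B (f : arr A B) : Id B ∘ f ≡ f
| Compa1 A B (f : arr A B) : f ∘ Id A ≡ f
| CompA A B C D (h : arr C D) (g : arr B C) (f : arr A B) :
    h ∘ (g ∘ f) ≡ (h ∘ g) ∘ f
(* functoriality *)
| TensorA_Id A B : Id A ⊗ Id B ≡ Id (A ⊗ B)
| TensorA_Comp A B C A' B' C'
    (g : arr B C) (f : arr A B) (g' : arr B' C') (f' : arr A' B') :
    (g ∘ f) ⊗ (g' ∘ f') ≡ (g ⊗ g') ∘ (f ⊗ f')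
| EllA_Id A : EllA (Id A) ≡ Id (Ell A)
| EllA_Comp A B C (g : arr B C) (f : arr A B) :
    EllA (g ∘ f) ≡ EllA g ∘ EllA f
(* naturality *)
| assoc_nat A B C A' B' C' (f : arr A A') (g : arr B B') (h : arr C C') :
    (f ⊗ (g ⊗ h)) ∘ assoc A B C ≡ assoc A' B' C' ∘ ((f ⊗ g) ⊗ h)
| lunit_nat A A' (f : arr A A') : f ∘ lunit A ≡ lunit A' ∘ (Id Unit ⊗ f)
| runit_nat A A' (f : arr A A') : f ∘ runit A ≡ runit A' ∘ (f ⊗ Id Unit)
| symm_nat A B A' B' (f : arr A A') (g : arr B B') :
    (g ⊗ f) ∘ symm A B ≡ symm A' B' ∘ (f ⊗ g)
| eps_nat A A' (f : arr A A') : f ∘ eps A ≡ eps A' ∘ EllA f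
| delta_nat A A' (f : arr A A') :
    EllA (EllA f) ∘ delta A ≡ delta A' ∘ EllA f
| psi_nat A B A' B' (f : arr A A') (g : arr B B') :
    EllA (f ⊗ g) ∘ psi A B ≡ psi A' B' ∘ (EllA f ⊗ EllA g)
(* symmetric monoidal category *)
| assocK A B C : assocV A B C ∘ assoc A B C ≡ Id _
| assocVK A B C : assoc A B C ∘ assocV A B C ≡ Id _
| lunitK A : lunitV A ∘ lunit A ≡ Id _
| lunitVK A : lunit A ∘ lunitV A ≡ Id _
| runitK A : runitV A ∘ runit A ≡ Id _
| runitVK A : runit A ∘ runitV A ≡ Id _
| pentagon A B C D :
    assoc A B (C ⊗ D) ∘ assoc (A ⊗ B) C D
    ≡ (Id A ⊗ assoc B C D) ∘ assoc A (B ⊗ C) D ∘ (assoc A B C ⊗ Id D)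
| triangle A B : (Id A ⊗ lunit B) ∘ assoc A Unit B ≡ runit A ⊗ Id B
| lunit_runit : lunit (@Unit P) ≡ runit Unit
| symmK A B : symm B A ∘ symm A B ≡ Id (A ⊗ B)
| symm_unit A : lunit A ∘ symm A Unit ≡ runit A
| hexagon A B C :
    assoc B C A ∘ symm A (B ⊗ C) ∘ assoc A B C
    ≡ (Id B ⊗ symm A C) ∘ assoc B A C ∘ (symm A B ⊗ Id C)
(* comonad *)
| eps_delta A : eps (Ell A) ∘ delta A ≡ Id (Ell A)
| Ell_eps_delta A : EllA (eps A) ∘ delta A ≡ Id (Ell A)
| deltaA A : EllA (delta A) ∘ delta A ≡ delta (Ell A) ∘ delta A
(* symmetric monoidal comonad *)
| psi_assoc A B C :
    EllA (assoc A B C) ∘ psi (A ⊗ B) C ∘ (psi A B ⊗ Id (Ell C))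
    ≡ psi A (B ⊗ C) ∘ (Id (Ell A) ⊗ psi B C)
      ∘ assoc (Ell A) (Ell B) (Ell C)
| psi_lunit A :
    EllA (lunit A) ∘ psi Unit A ∘ (psi0 ⊗ Id (Ell A)) ≡ lunit (Ell A)
| psi_runit A :
    EllA (runit A) ∘ psi A Unit ∘ (Id (Ell A) ⊗ psi0) ≡ runit (Ell A)
| psi_symm A B :
    EllA (symm A B) ∘ psi A B ≡ psi B A ∘ symm (Ell A) (Ell B)
| eps_psi A B : eps (A ⊗ B) ∘ psi A B ≡ eps A ⊗ eps B
| delta_psi A B :
    delta (A ⊗ B) ∘ psi A B
    ≡ EllA (psi A B) ∘ psi (Ell A) (Ell B) ∘ (delta A ⊗ delta B)
| eps_psi0 : eps Unit ∘ psi0 ≡ Id (@Unit P)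
| delta_psi0 : delta (@Unit P) ∘ psi0 ≡ EllA psi0 ∘ psi0
where "f ≡ g" := (eqarr f%arr g%arr).

Definition Rel (n m : nat) : Type := {set 'I_n * 'I_m}.

(* Restriction to [n * m] of a relation between natural numbers. *)
Definition rel_of n m (r : rel nat) : Rel n m := [set p : 'I_n * 'I_m | r p.1 p.2].

(* [holds R i j]: [i < n], [j < m] and [R] relates [i] to [j]. *)
Definition holds n m (R : Rel n m) (i j : nat) : bool :=
  [exists p in R, (i == p.1 :> nat) && (j == p.2 :> nat)].

Definition rid n m : Rel n m := rel_of n m (fun i j => i == j).

Definition rcomp n m k (S : Rel m k) (R : Rel n m) : Rel n k :=
  [set p | [exists x, ((p.1, x) \in R) && ((x, p.2) \in S)]].

(* Elements are counted from the right: the left factor [R] of a juxtaposition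
   lives on the larger elements. *)
Definition rtensor n m n' m' (R : Rel n m) (S : Rel n' m') :
    Rel (n + n') (m + m') :=
  rel_of _ _ (fun i j =>
    holds S i j || [&& n' <= i, m' <= j & holds R (i - n') (j - m')]).

Definition rEll n m (R : Rel n m) : Rel n.+1 m.+1 :=
  rel_of _ _ (fun i j => holds R i j || (i == n) && (j == m)).

Fixpoint gobj P (A : obj P) : nat :=
  match A with
  | Letter _ => 1
  | Unit => 0
  | Tensor A B => gobj A + gobj B
  | Ell A => (gobj A).+1
  end.

Definition rsymm a b : Rel (a + b) (b + a) :=
  rel_of _ _ (fun i j => j == if i < b then a + i else i - b).

Definition rdelta a : Rel a.+1 a.+2 :=
  rel_of _ _ (fun i j => (i == j) || (i == a) && (j == a.+1)).

(* In the source [LA ⊗ LB], with [a = GA] and [b = GB], the occurrences in [B]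
   are [0..b-1], the [L] of [LB] is [b], the occurrences in [A] are
   [b+1..b+a], and the [L] of [LA] is [b+a+1].  In the target [L(A ⊗ B)] the
   occurrences in [B] are [0..b-1], those in [A] are [b..b+a-1], and the
   outermost [L] is [a+b]. *)
Definition rpsi a b : Rel (a.+1 + b.+1) (a + b).+1 :=
  rel_of _ _ (fun i j => j ==
    if i < b then i
    else if i == b then a + b
    else if i <= b + a then i.-1
    else a + b).

Fixpoint garr P (A B : obj P) (f : arr A B) : Rel (gobj A) (gobj B) :=
  match f in arr A B return Rel (gobj A) (gobj B) with
  | Id _ => rid _ _
  | Comp _ _ _ g f => rcomp (garr g) (garr f)
  | TensorA _ _ _ _ f g => rtensor (garr f) (garr g)
  | EllA _ _ f => rEll (garr f)
  | assoc _ _ _ => rid _ _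
  | assocV _ _ _ => rid _ _
  | lunit _ => rid _ _
  | lunitV _ => rid _ _
  | runit _ => rid _ _
  | runitV _ => rid _ _
  | symm A B => rsymm (gobj A) (gobj B)
  | eps A => rid _ _
  | delta A => rdelta (gobj A)
  | psi A B => rpsi (gobj A) (gobj B)
  | psi0 => set0
  end.

(* The rest of this file shows that [garr] is well defined on equivalence
   classes of arrow terms (lemma [garr_eqarr]), so that [gobj] and [garr] are the
   object and arrow parts of a functor.  [wp R Q i] says that [R] relates [i] to
   some element satisfying [Q]; a relation is determined by [wp R], and [wp]
   turns composition of relations into composition of predicate transformers. *)
Definition wp n m (R : Rel n m) (Q : nat -> Prop) (i : nat) : Prop :=
  exists2 k, holds R i k & Q k.

Lemma holdsP n m (R : Rel n m) (i j : nat) :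
  reflect (exists p : 'I_n * 'I_m, [/\ p \in R, i = p.1 & j = p.2])
    (holds R i j).
Proof.
apply: (iffP existsP) => -[p].
  by case/and3P=> pR /eqP ei /eqP ej; exists p.
by case=> pR -> ->; exists p; rewrite pR !eqxx.
Qed.

Lemma holds_lt n m (R : Rel n m) i j : holds R i j -> i < n /\ j < m.
Proof. by case/holdsP=> p [_ -> ->]. Qed.

Lemma holds_mem n m (R : Rel n m) (p : 'I_n * 'I_m) :
  holds R p.1 p.2 = (p \in R).
Proof.
apply/holdsP/idP => [[q [qR e1 e2]]|pR]; last by exists p.
by rewrite [p]surjective_pairing (val_inj e1) (val_inj e2) -surjective_pairing.
Qed.

Lemma holds_rel_of n m r i j :
  holds (rel_of n m r) i j <-> [/\ i < n, j < m & r i j].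
Proof.
split=> [/holdsP[p [pR -> ->]]|[ltin ltjm rij]].
  by move: pR; rewrite inE.
by apply/holdsP; exists (Ordinal ltin, Ordinal ltjm); rewrite inE.
Qed.

Lemma wp_eq n m (R S : Rel n m) :
  (forall Q i, i < n -> wp R Q i <-> wp S Q i) -> R = S.
Proof.
move=> eqRS; apply/setP=> p; rewrite -!holds_mem; apply/idP/idP => h.
  have [] // := (eqRS (eq^~ (p.2 : nat)) p.1 (ltn_ord _)).1.
    by exists (p.2 : nat).
  by move=> k hk <-.
have [] // := (eqRS (eq^~ (p.2 : nat)) p.1 (ltn_ord _)).2.
  by exists (p.2 : nat).
by move=> k hk <-.
Qed.

Lemma wp_comp n m k (S : Rel m k) (R : Rel n m) Q i :
  wp (rcomp S R) Q i <-> wp R (wp S Q) i.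
Proof.
split=> [[j /holdsP[p []]]|[x hR [j hS Qj]]].
  rewrite inE => /existsP[x /andP[pR pS]] -> -> Qj.
  exists x; first by rewrite (holds_mem R (p.1, x)).
  by exists p.2; rewrite // (holds_mem S (x, p.2)).
exists j => //; move/holdsP: hR => [[p1 p2] /= [pR -> ex]].
move/holdsP: hS => [[q1 q2] /= [qS ex' ->]].
apply/holdsP; exists (p1, q2); split=> //; rewrite inE /=.
apply/existsP; exists p2; rewrite pR.
by have -> : p2 = q1 by apply: val_inj; rewrite /= -ex.
Qed.

Lemma wp_fun n m (r : rel nat) phi Q i :
    (forall i j, r i j = (j == phi i)) ->
  wp (rel_of n m r) Q i <-> [/\ i < n, phi i < m & Q (phi i)].
Proof.
move=> rE; split=> [[j /holds_rel_of[]]|[lti ltj Qi]].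
  by rewrite rE => ? ? /eqP <-.
by exists (phi i) => //; apply/holds_rel_of; rewrite rE.
Qed.

Lemma wp_id n m Q i : wp (rid n m) Q i <-> [/\ i < n, i < m & Q i].
Proof. exact: (@wp_fun n m _ id Q i (fun i j => eq_sym i j)). Qed.

Lemma wp_symm a b Q i :
  wp (rsymm a b) Q i <->
  (i < b /\ Q (a + i)) \/ [/\ b <= i, i < a + b & Q (i - b)].
Proof.
rewrite /rsymm wp_fun; last by [].
rewrite /=.
case: (ltnP i b) => lib; split.
- by case=> ? ? ?; left.
- by case=> [[? ?]|[? ? ?]]; [split=> //; lia | lia].
- by case=> ? ? ?; right.
- by case=> [[? ?]|[? ? ?]]; [lia | split=> //; lia].
Qed.

Lemma wp_psi a b Q i :
  wp (rpsi a b) Q i <->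
  [\/ i < b /\ Q i, i = b /\ Q (a + b), [/\ b < i, i <= b + a & Q i.-1]
    | i = (a + b).+1 /\ Q (a + b)].
Proof.
rewrite /rpsi wp_fun; last by [].
rewrite /=.
split.
  case=> h; case: (ltnP i b) => lib _; first by constructor 1.
  case: (i =P b) => [->|nib]; first by constructor 2.
  case: (leqP i (b + a)) => leib; first by constructor 3; split=> //; lia.
  by constructor 4; split=> //; lia.
case=> [[h q]|[h q]|[h h' q]|[h q]].
- by rewrite h; split=> //; lia.
- by rewrite h ltnn eqxx; split=> //; lia.
- have -> : (i < b) = false by lia.
  have -> : (i == b) = false by lia.
  by rewrite h'; split=> //; lia.
- have -> : (i < b) = false by lia.
  have -> : (i == b) = false by lia.
  have -> : (i <= b + a) = false by lia.
  by split=> //; lia.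
Qed.

Lemma wp_delta a Q i :
  wp (rdelta a) Q i <-> (i < a.+1 /\ Q i) \/ (i = a /\ Q a.+1).
Proof.
split=> [[j /holds_rel_of[lti ltj] h Qj]|].
  case/orP: h => [/eqP eij|/andP[/eqP ei /eqP ej]]; first by left; rewrite eij in lti *.
  by right; rewrite -ej.
case=> [[lti Qi]|[-> Qa]].
  by exists i => //; apply/holds_rel_of; split=> //; [lia | rewrite eqxx].
by exists a.+1 => //; apply/holds_rel_of; rewrite !eqxx orbT; split.
Qed.

Lemma wp_set0 n m Q i : wp (set0 : Rel n m) Q i <-> False.
Proof. by split=> // -[j /holdsP[p []]]; rewrite inE. Qed.

Lemma wp_tensor n m n' m' (R : Rel n m) (S : Rel n' m') Q i :
  wp (rtensor R S) Q i <->
  wp S Q i \/ n' <= i /\ wp R (fun k => Q (m' + k)) (i - n').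
Proof.
split=> [[j /holds_rel_of[_ _ /orP[h|/and3P[h1 h2 h3]]] Qj]|].
- by left; exists j.
- by right; split=> //; exists (j - m'); rewrite // subnKC.
case=> [[j h Qj]|[lei [j h Qj]]].
  exists j => //; apply/holds_rel_of; have [] := holds_lt h.
  by split; [lia | lia | rewrite h].
exists (m' + j) => //; apply/holds_rel_of; have [] := holds_lt h.
by rewrite addKn h lei leq_addr orbT; split=> //; lia.
Qed.

Lemma wp_Ell n m (R : Rel n m) Q i :
  wp (rEll R) Q i <-> wp R Q i \/ i = n /\ Q m.
Proof.
split=> [[j /holds_rel_of[_ _ /orP[h|/andP[/eqP ei /eqP ej]]] Qj]|].
- by left; exists j.
- by right; split=> //; case: _ / ej.
case=> [[j h Qj]|[-> Qm]].
  exists j => //; apply/holds_rel_of; have [] := holds_lt h.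
  by split; [lia | lia | rewrite h].
by exists m => //; apply/holds_rel_of; rewrite !eqxx orbT; split.
Qed.

Lemma wp_exists n m (R : Rel n m) (Q : nat -> Prop) i k i' :
  holds R i k -> i' = i -> Q k -> wp R Q i'.
Proof. by move=> h -> q; exists k. Qed.

Lemma eq_pred (Q : nat -> Prop) i j : Q i -> i = j -> Q j.
Proof. by move=> q <-. Qed.

Ltac arith :=
  repeat match goal with
  | H : is_true (holds _ _ _) |- _ => clear H
  | Q : nat -> Prop, H : _ |- _ => match type of H with Q _ => clear H end
  end; lia.

Ltac wp_hyp :=
  cbv beta;
  match goal with
  | |- wp (rcomp _ _) _ _ -> _ => move/wp_comp
  | |- wp (rid _ _) _ _ -> _ => move/wp_id => [? ?]
  | |- wp (rsymm _ _) _ _ -> _ => move/wp_symm => [[?]|[? ?]]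
  | |- wp (rpsi _ _) _ _ -> _ => move/wp_psi => [[?]|[?]|[? ?]|[?]]
  | |- wp (rdelta _) _ _ -> _ => move/wp_delta => [[?]|[?]]
  | |- wp set0 _ _ -> _ => move/wp_set0 => []
  | |- wp (rtensor _ _) _ _ -> _ => move/wp_tensor => [|[?]]
  | |- wp (rEll _) _ _ -> _ => move/wp_Ell => [|[?]]
  | |- wp _ _ _ -> _ =>
      let h := fresh "h" in case=> ? h; have [? ?] := holds_lt h
  end.

Ltac wp_goal :=
  cbv beta;
  match goal with
  | |- wp (rcomp _ _) _ _ => apply/wp_comp; wp_goal
  | |- wp (rid _ _) _ _ => apply/wp_id; split; [arith | arith | wp_goal]
  | |- wp (rsymm _ ?b) _ ?i => apply/wp_symm; case: (ltnP i b) => ?;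
      first [exfalso; arith | left; split; [arith | wp_goal]
            | right; split; [arith | arith | wp_goal]]
  | |- wp (rpsi ?a ?b) _ ?i => apply/wp_psi;
      case: (ltngtP i b) => ?; case: (leqP i (b + a)) => ?;
      first [exfalso; arith | constructor 1; split; [arith | wp_goal]
            | constructor 2; split; [arith | wp_goal]
            | constructor 3; split; [arith | arith | wp_goal]
            | constructor 4; split; [arith | wp_goal]]
  | |- wp (rdelta ?a) _ ?i => apply/wp_delta; case: (ltnP i a) => ?;
      first [left; split; [arith | wp_goal]
            | right; split; [arith | wp_goal]]
  | |- wp (@rtensor _ _ ?n _ _ _) _ ?i => apply/wp_tensor;
      case: (ltnP i n) => ?; first [exfalso; arith | left; wp_goal | right; split; [arith | wp_goal]]
  | |- wp (@rEll ?n _ _) _ ?i => apply/wp_Ell;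
      case: (ltnP i n) => ?; first [exfalso; arith | left; wp_goal | right; split; [arith | wp_goal]]
  | h : is_true (holds ?f _ _) |- wp ?f _ _ =>
      apply: (wp_exists h); [arith | wp_goal]
  | H : ?Q _ |- ?Q _ => apply: (eq_pred H); arith
  end.

Ltac wp_solve :=
  move=> * /=; apply: wp_eq => Q i /= lti; split; repeat wp_hyp; cbv beta;
  move=> ?; first [by exfalso; arith | wp_goal].

Lemma garr_eqarr P (A B : obj P) (f g : arr A B) : f ≡ g -> garr f = garr g.
Proof.
elim=> {A B f g}.
- by [].
- by move=> A B f g _ ->.
- by move=> A B f g h _ -> _ ->.
- by move=> A B C g g' f f' _ /= -> _ ->.
- by move=> A B A' B' f f' g g' _ /= -> _ ->.
- by move=> A B f f' _ /= ->.
all: wp_solve.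
Qed.

(* Main.v *)
Require Import Defs.
From mathcomp Require Import all_boot.
From mathcomp Require Import zify.
From Stdlib Require Import Setoid Morphisms ProofIrrelevance.

(** Faithfulness of [garr] is proved by induction on the target [B] of two arrows
    [f, g : arr A B] with [garr f = garr g], for all sources [A] at once.  Each
    case needs a normal form of [f]: a canonical arrow out of [A], determined by
    [garr f], followed by arrows into the immediate subexpressions of [B].

    The normal forms all arise in the same way.  One defines, by recursion on an
    object [A], a type of patterns on [A] and, for each pattern, an arrow out of
    [A], built from copies of a few structural maps.  Then one shows, by
    induction on the arrow terms, that these arrows are natural up to pulling
    patterns back: for every [f : arr A B] and every pattern on [B] there are a
    pattern on [A] and an arrow between the residual objects that close the
    naturality square.  Applied to a trivial pattern on the target, this
    factors [f] through a pattern arrow.  There are four instances.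

    - If [B] is [Unit] or a letter, the pattern says that [A] has no letter, or
      exactly one, and the arrow erases everything else with [eps].  There is at
      most one pattern, hence at most one arrow ([to_Unit], [to_Letter]).
    - A pruning marks some occurrences of [L], which are erased with [eps].
      Every arrow factors through a pruning followed by an arrow with a total
      relation ([prune_factor]).
    - A cut chooses occurrences of [L], pairwise incomparable and jointly above
      all letters; erasing the [L]s that are not below or in the cut, and
      comultiplying those in it, makes the rest a coalgebra
      [arr A (Ell (cobj c))].  Every arrow to [Ell B] is [EllA f'] after such a
      coalgebra ([cut_factor]), since [delta B] is the coalgebra of the cut at
      the outermost [L].
    - A splitting distributes the letters, and some whole subexpressions [Ell A],
      over two sides, erasing the remaining [L]s.  Every arrow to [B1 ⊗ B2] is
      a splitting followed by some [f1 ⊗ f2] ([split_factor]).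

    It remains to read the patterns off the relation.  The domain of [garr f]
    determines the pruning ([prune_inj]); the occurrences related to the
    outermost [L] of the target are the cut ([cut_inj]); and when [garr f] is
    total, the side of the target on which an occurrence has an image
    determines the splitting ([side_inj]).  For this reason one prunes before
    splitting: an unrelated [L] could be put on either side.  Finally the
    relations of the pattern arrows are split epimorphisms, apart from the extra
    outermost [L] in the case of cuts, and can be cancelled; so the residual
    arrows of [f] and [g] have equal relations too, and the induction
    hypothesis applies to them. *)

Set Implicit Arguments.
Unset Strict Implicit.
Unset Printing Implicit Defensive.

Local Open Scope arr_scope.

(** * Symmetric monoidal coherence *)

#[local] Instance eqarr_equiv P (A B : obj P) : Equivalence (@eqarr P A B).
Proof.
by split; [exact: eqarr_refl | exact: eqarr_sym | exact: eqarr_trans].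
Qed.

#[local] Instance Comp_proper P (A B C : obj P) :
  Proper (@eqarr P B C ==> @eqarr P A B ==> @eqarr P A C) (@Comp P A B C).
Proof. by move=> g g' eg f f' ef; apply: eqarr_Comp. Qed.

#[local] Instance TensorA_proper P (A B A' B' : obj P) :
  Proper (@eqarr P A A' ==> @eqarr P B B' ==> @eqarr P _ _)
    (@TensorA P A B A' B').
Proof. by move=> g g' eg f f' ef; apply: eqarr_TensorA. Qed.

#[local] Instance EllA_proper P (A B : obj P) :
  Proper (@eqarr P A B ==> @eqarr P _ _) (@EllA P A B).
Proof. by move=> f f' ef; apply: eqarr_EllA. Qed.

#[local] Hint Resolve eqarr_refl : core.

Lemma comp_eq2 P (A B C D : obj P) (g : arr B C) (f : arr A B) h (x : arr C D) :
  g ∘ f ≡ h -> x ∘ g ∘ f ≡ x ∘ h.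
Proof. by rewrite -CompA => ->. Qed.

Lemma comp_eq3 P (A B C D E : obj P) (g1 : arr C D) (g : arr B C) (f : arr A B) h
  (x : arr D E) :
  g1 ∘ g ∘ f ≡ h -> x ∘ g1 ∘ g ∘ f ≡ x ∘ h.
Proof. by rewrite -!CompA => ->. Qed.

(** [post E] is [E], an equation between composites, preceded by an arbitrary
    arrow; [rw] uses it to rewrite inside a left-nested chain of compositions,
    where the left-hand side of [E] is a subterm only at the head of the chain.
    Facts about every set of letters are used for the one at hand. *)
Ltac post E :=
  let T := type of E in
  lazymatch T with
  | forall x : Type, _ =>
      match goal with P : Type |- _ => let r := post (E P) in constr:(r) end
  | forall x : ?X, _ => constr:(fun x : X => ltac:(let r := post (E x) in exact r))
  | _ ∘ _ ∘ _ ≡ _ => constr:(fun D x => @comp_eq3 _ _ _ _ _ D _ _ _ _ x E)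
  | _ ∘ _ ≡ _ => constr:(fun D x => @comp_eq2 _ _ _ _ D _ _ _ x E)
  end.

Ltac rw E :=
  rewrite ?CompA;
  first [ rewrite -> E | let H := post E in rewrite -> H ];
  rewrite ?CompA.

Ltac symE E :=
  let T := type of E in
  lazymatch T with
  | forall x : Type, _ =>
      match goal with P : Type |- _ => let r := symE (E P) in constr:(r) end
  | forall x : ?X, _ => constr:(fun x : X => ltac:(let r := symE (E x) in exact r))
  | _ => constr:(eqarr_sym E)
  end.

(** Rewriting from right to left. *)
Ltac rwr E := let H := symE E in rw H.

Section Coherence.
Variable P : Type.
Implicit Types A B C D : obj P.

Lemma comp_cancel_r A B C (f g : arr B C) (e : arr A B) (e' : arr B A) :
  e ∘ e' ≡ Id B -> f ∘ e ≡ g ∘ e -> f ≡ g.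
Proof.
move=> ee h; rewrite -(Compa1 f) -(Compa1 g) -ee 2!CompA h //.
Qed.

Lemma comp_cancel_l A B C (f g : arr A B) (e : arr B C) (e' : arr C B) :
  e' ∘ e ≡ Id B -> e ∘ f ≡ e ∘ g -> f ≡ g.
Proof.
move=> ee h; rewrite -(Comp1a f) -(Comp1a g) -ee -2!CompA h //.
Qed.

(** [Unit ⊗ -] is naturally isomorphic to the identity functor, hence faithful. *)
Lemma tensor_unit_l_inj A B (f g : arr A B) : Id Unit ⊗ f ≡ Id Unit ⊗ g -> f ≡ g.
Proof.
move=> h; apply: (comp_cancel_r (lunitVK A)).
by rewrite !lunit_nat h.
Qed.

Lemma tensor_unit_r_inj A B (f g : arr A B) : f ⊗ Id Unit ≡ g ⊗ Id Unit -> f ≡ g.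
Proof.
move=> h; apply: (comp_cancel_r (runitVK A)).
by rewrite !runit_nat h.
Qed.

Lemma tensor_comp_l A B C X (g : arr B C) (f : arr A B) :
  Id X ⊗ (g ∘ f) ≡ (Id X ⊗ g) ∘ (Id X ⊗ f).
Proof. by rewrite -TensorA_Comp Comp1a. Qed.

Lemma whisker_l3 X A B C D B' C' (h : arr C D) (g : arr B C) (f : arr A B)
  (h' : arr C' D) (g' : arr B' C') (f' : arr A B') :
  h ∘ g ∘ f ≡ h' ∘ g' ∘ f' ->
  (Id X ⊗ h) ∘ (Id X ⊗ g) ∘ (Id X ⊗ f)
  ≡ (Id X ⊗ h') ∘ (Id X ⊗ g') ∘ (Id X ⊗ f').
Proof. by move=> e; rewrite -!tensor_comp_l e. Qed.

Lemma tensor_comp_r A B C X (g : arr B C) (f : arr A B) :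
  (g ∘ f) ⊗ Id X ≡ (g ⊗ Id X) ∘ (f ⊗ Id X).
Proof. by rewrite -TensorA_Comp Comp1a. Qed.

Lemma tensor_lr A B A' B' (f : arr A A') (g : arr B B') :
  f ⊗ g ≡ (f ⊗ Id _) ∘ (Id _ ⊗ g).
Proof. by rewrite -TensorA_Comp Comp1a Compa1. Qed.

Lemma tensor_rl A B A' B' (f : arr A A') (g : arr B B') :
  f ⊗ g ≡ (Id _ ⊗ g) ∘ (f ⊗ Id _).
Proof. by rewrite -TensorA_Comp Comp1a Compa1. Qed.

(** This and [runit_tensor] are Kelly's redundant axioms.  After tensoring with
    [Unit] and composing with associators, the pentagon reduces them to the
    triangle. *)
Lemma lunit_tensor A B : lunit (A ⊗ B) ∘ assoc Unit A B ≡ lunit A ⊗ Id B.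
Proof.
apply: tensor_unit_l_inj.
apply: (comp_cancel_r (assocVK _ _ _)).
have ak : (assoc Unit Unit A ⊗ Id B) ∘ (assocV Unit Unit A ⊗ Id B) ≡ Id _.
  by rewrite -tensor_comp_r assocVK TensorA_Id.
apply: (comp_cancel_r ak).
rw tensor_comp_l.
rwr pentagon.
rw triangle.
rewrite -TensorA_Id.
rw assoc_nat.
rewrite -triangle tensor_comp_r.
by rw assoc_nat.
Qed.

Lemma runit_tensor A B : (Id A ⊗ runit B) ∘ assoc A B Unit ≡ runit (A ⊗ B).
Proof.
apply: tensor_unit_r_inj.
apply: (comp_cancel_l (assocK _ _ _)).
rw tensor_comp_r.
rwr assoc_nat.
rewrite -triangle tensor_comp_l.
rwr pentagon.
rw assoc_nat.
by rewrite TensorA_Id -CompA triangle.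
Qed.

Lemma runit_symm A : runit A ∘ symm Unit A ≡ lunit A.
Proof. by rewrite -symm_unit -CompA symmK Compa1. Qed.

Lemma symm_unit_unit : symm Unit Unit ≡ Id (@Unit P ⊗ Unit).
Proof.
apply: (comp_cancel_l (lunitK _)).
by rewrite symm_unit Compa1 lunit_runit.
Qed.

Lemma runitV_lunitV : runitV (@Unit P) ≡ lunitV Unit.
Proof.
apply: (comp_cancel_l (lunitK _)).
by rewrite lunitVK lunit_runit runitVK.
Qed.

Lemma runitV_nat A B (f : arr A B) : (f ⊗ Id Unit) ∘ runitV A ≡ runitV B ∘ f.
Proof.
apply: (comp_cancel_l (runitK _)).
by rewrite !CompA -runit_nat runitVK Comp1a -CompA runitVK Compa1.
Qed.

Lemma lunitV_nat A B (f : arr A B) : (Id Unit ⊗ f) ∘ lunitV A ≡ lunitV B ∘ f.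
Proof.
apply: (comp_cancel_l (lunitK _)).
by rewrite !CompA -lunit_nat lunitVK Comp1a -CompA lunitVK Compa1.
Qed.

Lemma assocV_nat A B C A' B' C' (f : arr A A') (g : arr B B') (h : arr C C') :
  ((f ⊗ g) ⊗ h) ∘ assocV A B C ≡ assocV A' B' C' ∘ (f ⊗ (g ⊗ h)).
Proof.
apply: (comp_cancel_l (assocK _ _ _)).
rwr assoc_nat.
by rewrite assocVK Comp1a -CompA assocVK Compa1.
Qed.

(** The braiding of the functors [A ⊗ -] and [B ⊗ -].  It is [locked] so that
    unification does not take it for a composite. *)
Definition swap A B X : arr (A ⊗ (B ⊗ X)) (B ⊗ (A ⊗ X)) :=
  locked (assoc B A X ∘ (symm A B ⊗ Id X) ∘ assocV A B X).

Lemma swapE A B X :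
  swap A B X ≡ assoc B A X ∘ (symm A B ⊗ Id X) ∘ assocV A B X.
Proof. by rewrite /swap -lock. Qed.

Lemma swap_nat A B X A' B' X' (f : arr A A') (g : arr B B') (x : arr X X') :
  (g ⊗ (f ⊗ x)) ∘ swap A B X ≡ swap A' B' X' ∘ (f ⊗ (g ⊗ x)).
Proof.
rewrite !swapE.
rw assoc_nat.
rwr TensorA_Comp.
rewrite symm_nat Compa1 -[x in (_ ⊗ x)](Comp1a x) TensorA_Comp.
by rw assocV_nat.
Qed.

Lemma pentagon_aV A B C D :
  assoc (A ⊗ B) C D ∘ (assocV A B C ⊗ Id D)
  ≡ assocV A B (C ⊗ D) ∘ (Id A ⊗ assoc B C D) ∘ assoc A (B ⊗ C) D.
Proof.
apply: (comp_cancel_l (assocK _ _ _)).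
rw pentagon.
rwr tensor_comp_r.
by rewrite assocVK assocVK TensorA_Id Compa1 Comp1a.
Qed.

Lemma pentagon_V A B C D :
  assoc A (B ⊗ C) D ∘ (assoc A B C ⊗ Id D) ∘ assocV (A ⊗ B) C D
  ≡ (Id A ⊗ assocV B C D) ∘ assoc A B (C ⊗ D).
Proof.
apply: (@comp_cancel_l _ _ _ _ _ (Id A ⊗ assoc B C D) (Id A ⊗ assocV B C D)).
  by rewrite -tensor_comp_l assocK TensorA_Id.
rwr pentagon.
rw assocVK.
by rewrite -tensor_comp_l assocVK TensorA_Id Compa1 Comp1a.
Qed.

(** The inverse of the hexagon. *)
Lemma symm_assocV A B C :
  assocV C A B ∘ symm (A ⊗ B) C
  ≡ (symm A C ⊗ Id B) ∘ assocV A C B ∘ (Id A ⊗ symm B C) ∘ assoc A B C.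
Proof.
apply: (@comp_cancel_l _ _ _ _ _ ((Id A ⊗ symm C B) ∘ assoc A C B ∘ (symm C A ⊗ Id B))
  ((symm A C ⊗ Id B) ∘ assocV A C B ∘ (Id A ⊗ symm B C))).
  rewrite !CompA.
  rwr tensor_comp_l. rewrite symmK TensorA_Id Compa1.
  rw assocK. rewrite Compa1.
  by rewrite -tensor_comp_r symmK TensorA_Id.
rewrite -{1}hexagon.
rw assocVK. rewrite Compa1.
rw symmK. rewrite Compa1.
rwr tensor_comp_r. rewrite symmK TensorA_Id Compa1.
rw assocVK. rewrite Compa1.
by rewrite -tensor_comp_l symmK TensorA_Id Comp1a.
Qed.

Lemma swapK A B X : swap B A X ∘ swap A B X ≡ Id _.
Proof.
rewrite !swapE !CompA.
rw assocK. rewrite Compa1.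
rwr tensor_comp_r. rewrite symmK TensorA_Id Compa1.
by rw assocVK.
Qed.

(** Moving [A ⊗ B] past [C] is moving [B] and then [A]: the hexagon for functors. *)
Lemma swap_tensor_l A B C X :
  (Id C ⊗ assoc A B X) ∘ swap (A ⊗ B) C X
  ≡ swap A C (B ⊗ X) ∘ (Id A ⊗ swap B C X) ∘ assoc A B (C ⊗ X).
Proof.
apply: (@comp_cancel_r _ _ _ _ _ (assoc _ _ _) (assocV _ _ _)); first exact: assocVK.
rewrite !swapE !CompA.
rw assocK. rewrite Compa1.
have -> : (Id C ⊗ assoc A B X) ∘ assoc C (A ⊗ B) X
  ≡ assoc C A (B ⊗ X) ∘ assoc (C ⊗ A) B X ∘ (assocV C A B ⊗ Id X).
  rw pentagon_aV.
  by rewrite assocVK Comp1a.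
rwr tensor_comp_r.
rewrite symm_assocV.
rewrite !tensor_comp_r !CompA.
rwr assoc_nat. rewrite TensorA_Id.
rw pentagon_aV.
rwr assoc_nat.
rewrite !tensor_comp_l !CompA.
rwr pentagon_V.
by rw assocK; rewrite Compa1.
Qed.

Lemma tensor_assoc_iso A B C X : (Id X ⊗ assocV A B C) ∘ (Id X ⊗ assoc A B C) ≡ Id _.
Proof. by rewrite -tensor_comp_l assocK TensorA_Id. Qed.

Lemma swap_tensor_r A B C X :
  assoc B C (A ⊗ X) ∘ swap A (B ⊗ C) X
  ≡ (Id B ⊗ swap A C X) ∘ swap A B (C ⊗ X) ∘ (Id A ⊗ assoc B C X).
Proof.
apply: (@comp_cancel_l _ _ _ _ _
  (swap B A (C ⊗ X) ∘ (Id B ⊗ swap C A X))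
  ((Id B ⊗ swap A C X) ∘ swap A B (C ⊗ X))).
  rewrite !CompA. rw swapK. rewrite Compa1.
  by rewrite -tensor_comp_l swapK TensorA_Id.
rewrite !CompA.
rwr swap_tensor_l.
rw swapK. rewrite Compa1.
rwr tensor_comp_l. rewrite swapK TensorA_Id Compa1.
by rewrite swapK Comp1a.
Qed.

(** Two pentagons and the naturality of [assoc]. *)
Lemma swap_assoc A B X Y :
  (Id B ⊗ assoc A X Y) ∘ assoc B (A ⊗ X) Y ∘ (swap A B X ⊗ Id Y)
  ≡ swap A B (X ⊗ Y) ∘ (Id A ⊗ assoc B X Y) ∘ assoc A (B ⊗ X) Y.
Proof.
rewrite !swapE !tensor_comp_r !CompA.
rwr pentagon.
rwr assoc_nat. rewrite TensorA_Id.
by rw pentagon_aV.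
Qed.

Lemma swap_unit_l A X : (Id A ⊗ lunit X) ∘ swap Unit A X ≡ lunit (A ⊗ X).
Proof.
rewrite !swapE; rw triangle.
rwr tensor_comp_r. rewrite runit_symm -lunit_tensor.
by rewrite -CompA assocVK Compa1.
Qed.

Lemma swap_unit_r A X : lunit (A ⊗ X) ∘ swap A Unit X ≡ Id A ⊗ lunit X.
Proof.
rewrite !swapE; rw lunit_tensor.
rwr tensor_comp_r. rewrite symm_unit -triangle.
by rewrite -CompA assocVK Compa1.
Qed.

(** The middle-four interchange. *)
Definition mid A A' B B' : arr ((A ⊗ A') ⊗ (B ⊗ B')) ((A ⊗ B) ⊗ (A' ⊗ B')) :=
  locked (assocV A B (A' ⊗ B') ∘ (Id A ⊗ swap A' B B') ∘ assoc A A' (B ⊗ B')).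

Lemma midE A A' B B' :
  mid A A' B B'
  ≡ assocV A B (A' ⊗ B') ∘ (Id A ⊗ swap A' B B') ∘ assoc A A' (B ⊗ B').
Proof. by rewrite /mid -lock. Qed.

Lemma assoc_mid A A' B B' :
  assoc A B (A' ⊗ B') ∘ mid A A' B B'
  ≡ (Id A ⊗ swap A' B B') ∘ assoc A A' (B ⊗ B').
Proof. by rewrite !midE; rw assocVK; rewrite Comp1a. Qed.

Lemma mid_nat A A' B B' X X' Y Y' (f : arr A X) (f' : arr A' X')
  (g : arr B Y) (g' : arr B' Y') :
  ((f ⊗ g) ⊗ (f' ⊗ g')) ∘ mid A A' B B' ≡ mid X X' Y Y' ∘ ((f ⊗ f') ⊗ (g ⊗ g')).
Proof.
rewrite !midE; rw assocV_nat.
rwr TensorA_Comp. rewrite swap_nat Compa1 -[f in (f ⊗ _)](Comp1a f) TensorA_Comp.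
by rw assoc_nat.
Qed.

(** In the fully right-nested form, both sides become the three swaps of [A'] with
    [B], [A'] with [C] and [B'] with [C]; the last one commutes with the first by
    naturality. *)
Lemma mid_assoc A A' B B' C C' :
  (assoc A B C ⊗ assoc A' B' C') ∘ mid (A ⊗ B) (A' ⊗ B') C C'
    ∘ (mid A A' B B' ⊗ Id (C ⊗ C'))
  ≡ mid A A' (B ⊗ C) (B' ⊗ C') ∘ (Id (A ⊗ A') ⊗ mid B B' C C')
    ∘ assoc (A ⊗ A') (B ⊗ B') (C ⊗ C').
Proof.
apply: (comp_cancel_l (assocK _ _ _)).
apply: (comp_cancel_l (tensor_assoc_iso _ _ _ _)).
rewrite !CompA.
rewrite (tensor_lr (assoc A B C) (assoc A' B' C')) !CompA.
rwr pentagon.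
rewrite -(TensorA_Id (A ⊗ B) C).
rwr assoc_nat.
rw assoc_mid.
rwr tensor_comp_l.
rewrite swap_tensor_l.
rewrite -(TensorA_Id A B).
rwr assoc_nat.
rw pentagon.
rwr tensor_comp_r.
rewrite assoc_mid tensor_comp_r !tensor_comp_l !CompA.
rwr assoc_nat.
rw (whisker_l3 A (swap_assoc A' B B' (C ⊗ C'))).
rwr pentagon.
rw assoc_mid.
rewrite -(TensorA_Id A A').
rwr assoc_nat.
have e : (Id A ⊗ assoc B C (A' ⊗ (B' ⊗ C'))) ∘ (Id A ⊗ swap A' (B ⊗ C) (B' ⊗ C'))
  ∘ (Id A ⊗ (Id A' ⊗ mid B B' C C'))
  ≡ (Id A ⊗ (Id B ⊗ swap A' C (B' ⊗ C')))
    ∘ (Id A ⊗ (Id B ⊗ (Id A' ⊗ swap B' C C')))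
    ∘ (Id A ⊗ swap A' B (B' ⊗ (C ⊗ C'))) ∘ (Id A ⊗ (Id A' ⊗ assoc B B' (C ⊗ C'))).
  rewrite -!tensor_comp_l swap_tensor_r; apply: eqarr_TensorA => //.
  rwr (fun X Y Z => @tensor_comp_l X Y Z A'). rewrite assoc_mid tensor_comp_l.
  rwr swap_nat.
  by rewrite tensor_comp_l.
by rw e.
Qed.

(** The hexagon splits [symm (A ⊗ A') (B ⊗ B')] into four
    crossings, of which [mid B B' A A'] undoes the one of [A] and [B']. *)
Lemma mid_symm A A' B B' :
  (symm A B ⊗ symm A' B') ∘ mid A A' B B'
  ≡ mid B B' A A' ∘ symm (A ⊗ A') (B ⊗ B').
Proof.
have -> : symm (A ⊗ A') (B ⊗ B') ≡
  assocV B B' (A ⊗ A') ∘ (Id B ⊗ symm (A ⊗ A') B') ∘ swap (A ⊗ A') B B'.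
  apply: (comp_cancel_l (assocK _ _ _)).
  apply: (comp_cancel_r (assocVK _ _ _)).
  rewrite hexagon.
  rw assocVK. rewrite Comp1a swapE.
  rw assocK. by rewrite Compa1.
rewrite !midE; rw assocVK; rewrite Compa1.
have e : swap B' A A' ∘ symm (A ⊗ A') B' ≡ (Id A ⊗ symm A' B') ∘ assoc A A' B'.
  rewrite swapE. rw symm_assocV.
  rwr tensor_comp_r. rewrite symmK TensorA_Id Compa1.
  by rw assocVK; rewrite Comp1a.
rwr tensor_comp_l. rewrite e tensor_comp_l.
rw swap_tensor_l.
rwr assocV_nat.
rewrite TensorA_Id (swapE A B).
rw assocK. rewrite Compa1.
rwr TensorA_Comp.
by rewrite Comp1a Compa1.
Qed.

Lemma mid_lunit A A' :
  (lunit A ⊗ lunit A') ∘ mid Unit Unit A A' ∘ (lunitV Unit ⊗ Id (A ⊗ A'))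
  ≡ lunit (A ⊗ A').
Proof.
rewrite midE tensor_lr -(TensorA_Id Unit A).
rw assocV_nat.
have -> : (lunit A ⊗ Id A') ∘ assocV Unit A A' ≡ lunit (A ⊗ A').
  by rewrite -lunit_tensor -CompA assocVK Compa1.
rwr tensor_comp_l. rewrite swap_unit_l.
rw triangle.
rwr tensor_comp_r.
by rewrite -lunit_runit lunitVK TensorA_Id Compa1.
Qed.

Lemma mid_runit A A' :
  (runit A ⊗ runit A') ∘ mid A A' Unit Unit ∘ (Id (A ⊗ A') ⊗ lunitV Unit)
  ≡ runit (A ⊗ A').
Proof.
rewrite -2!symm_unit TensorA_Comp.
rw mid_symm.
rwr symm_nat.
by rewrite mid_lunit symm_unit.
Qed.

Lemma mid_unit_right A B :
  runit (A ⊗ B) ∘ (Id (A ⊗ B) ⊗ lunit Unit) ∘ mid A Unit B Unit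
  ≡ runit A ⊗ runit B.
Proof.
rewrite midE -(TensorA_Id A B).
rw assocV_nat.
rewrite -runit_tensor.
rw assocVK. rewrite Compa1.
rewrite -!tensor_comp_l -CompA swap_unit_l tensor_comp_l.
rw triangle.
by rewrite -TensorA_Comp Comp1a Compa1.
Qed.

Lemma mid_unit_left A B :
  lunit (A ⊗ B) ∘ (lunit Unit ⊗ Id (A ⊗ B)) ∘ mid Unit A Unit B
  ≡ lunit A ⊗ lunit B.
Proof.
rewrite midE -lunit_tensor.
rw assocVK. rewrite Compa1.
rwr lunit_nat.
rw swap_unit_r.
rw lunit_tensor.
by rewrite -TensorA_Comp Comp1a Compa1.
Qed.

Lemma mid_unit A B : mid A Unit Unit B ≡ Id _.
Proof.
rewrite midE swapE symm_unit_unit TensorA_Id Compa1 assocVK TensorA_Id Compa1.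
exact: assocK.
Qed.

End Coherence.

(** * Relations between finite ordinals *)

Section RelationCalculus.

Lemma holds_wp n m (R : Rel n m) i j : holds R i j <-> wp R (eq^~ j) i.
Proof. by split=> [h|[k h <-]] //; exists j. Qed.

Lemma holds_eq n m (R S : Rel n m) :
  (forall i j, holds R i j <-> holds S i j) -> R = S.
Proof. by move=> e; apply: wp_eq => Q i _; split=> -[k /e h q]; exists k. Qed.

Lemma holds_comp n m k (S : Rel m k) (R : Rel n m) i j :
  holds (rcomp S R) i j <-> exists2 x, holds R i x & holds S x j.
Proof.
rewrite holds_wp wp_comp; split=> -[x h].
  by rewrite -holds_wp; exists x.
by exists x => //; apply/holds_wp.
Qed.

Lemma holds_tensor n m n' m' (R : Rel n m) (S : Rel n' m') i j :
  holds (rtensor R S) i j <->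
  holds S i j \/ [/\ n' <= i, m' <= j & holds R (i - n') (j - m')].
Proof.
rewrite holds_wp wp_tensor -holds_wp; split=> -[h|]; try by left.
- by case=> h [k h2 <-]; right; split; rewrite ?leq_addr // addKn.
- by case=> h1 h2 h3; right; split=> //; exists (j - m') => //; rewrite subnKC.
Qed.

Lemma holds_Ell n m (R : Rel n m) i j :
  holds (rEll R) i j <-> holds R i j \/ i = n /\ j = m.
Proof. by rewrite holds_wp wp_Ell -holds_wp; intuition. Qed.

Lemma holds_id n m i j : holds (rid n m) i j <-> [/\ i < n, i < m & i = j].
Proof. by rewrite holds_wp wp_id. Qed.

Lemma holds_symm a b i j : holds (rsymm a b) i j <->
  (i < b /\ a + i = j) \/ [/\ b <= i, i < a + b & i - b = j].
Proof. by rewrite holds_wp wp_symm. Qed.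

Lemma holds_psi a b i j : holds (rpsi a b) i j <->
  [\/ i < b /\ i = j, i = b /\ a + b = j, [/\ b < i, i <= b + a & i.-1 = j]
    | i = (a + b).+1 /\ a + b = j].
Proof. by rewrite holds_wp wp_psi. Qed.

Lemma holds_delta a i j :
  holds (rdelta a) i j <-> (i < a.+1 /\ i = j) \/ (i = a /\ a.+1 = j).
Proof. by rewrite holds_wp wp_delta. Qed.

Definition rtotal n m (R : Rel n m) := forall i, i < n -> exists j, holds R i j.

Lemma total_comp n m k (S : Rel m k) (R : Rel n m) :
  rtotal S -> rtotal R -> rtotal (rcomp S R).
Proof.
move=> tS tR i /tR[x h]; have [_ /tS[j h']] := holds_lt h.
by exists j; apply/holds_comp; exists x.
Qed.

Lemma total_tensor n m n' m' (R : Rel n m) (S : Rel n' m') :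
  rtotal R -> rtotal S -> rtotal (rtensor R S).
Proof.
move=> tR tS i lti; have [/tS[j h]|lei] := ltnP i n'.
  by exists j; apply/holds_tensor; left.
have [|j h] := tR (i - n'); first lia.
by exists (m' + j); apply/holds_tensor; right; rewrite addKn leq_addr.
Qed.

Lemma total_Ell n m (R : Rel n m) : rtotal R -> rtotal (rEll R).
Proof.
move=> tR i; rewrite ltnS leq_eqVlt => /orP[/eqP ->|/tR[j h]].
  by exists m; apply/holds_Ell; right.
by exists j; apply/holds_Ell; left.
Qed.

Lemma total_id n m : n <= m -> rtotal (rid n m).
Proof. by move=> le i lt; exists i; apply/holds_id; split=> //; lia. Qed.

Lemma total_symm a b : rtotal (rsymm a b).
Proof.
move=> i lt; have [h|h] := ltnP i b.
  by exists (a + i); apply/holds_symm; left.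
by exists (i - b); apply/holds_symm; right.
Qed.

Lemma total_psi a b : rtotal (rpsi a b).
Proof.
move=> i lt; have [h|h] := ltnP i b.
  by exists i; apply/holds_psi; constructor 1.
case: (i =P b) => e; first by exists (a + b); apply/holds_psi; constructor 2.
have [h'|h'] := leqP i (b + a).
  by exists i.-1; apply/holds_psi; constructor 3; split=> //; lia.
by exists (a + b); apply/holds_psi; constructor 4; split=> //; lia.
Qed.

Lemma total_delta a : rtotal (rdelta a).
Proof. by move=> i lt; exists i; apply/holds_delta; left. Qed.

(** Equivalently, [rcomp R S] is the identity for some relation [S], which sends each
    [k] to such an [i]. *)
Definition split_epi n m (R : Rel n m) :=
  forall k, k < m -> exists i, forall j, holds R i j <-> j = k.

Lemma split_epi_cancel n m k (S S' : Rel m k) (R : Rel n m) :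
  split_epi R -> rcomp S R = rcomp S' R -> S = S'.
Proof.
move=> cR e; apply: holds_eq => x j.
suff main (T T' : Rel m k) :
    rcomp T R = rcomp T' R -> holds T x j -> holds T' x j.
  by split; apply: main.
move=> e' h; have [/cR[i hi] _] := holds_lt h.
have : holds (rcomp T R) i j by apply/holds_comp; exists x => //; apply/hi.
by rewrite e' => /holds_comp[y /hi ->].
Qed.

Lemma split_epi_comp n m k (S : Rel m k) (R : Rel n m) :
  split_epi S -> split_epi R -> split_epi (rcomp S R).
Proof.
move=> cS cR z /cS[y hy].
have [_] : True /\ y < m.
  by have /holds_lt[] := (hy z).2 erefl.
move/cR=> [x hx]; exists x => j; split=> [/holds_comp[t /hx -> /hy]|->] //.
by apply/holds_comp; exists y; [apply/hx | apply/hy].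
Qed.

Lemma split_epi_tensor n m n' m' (R : Rel n m) (S : Rel n' m') :
  split_epi R -> split_epi S -> split_epi (rtensor R S).
Proof.
move=> cR cS k ltk; have [/cS[i hi]|lek] := ltnP k m'.
  exists i => j; split=> [/holds_tensor[/hi|[lei]]|->] //.
    by have /holds_lt[] := (hi k).2 erefl; lia.
  by apply/holds_tensor; left; apply/hi.
have [|i hi] := cR (k - m'); first lia.
exists (n' + i) => j; split=> [/holds_tensor[/holds_lt|[_ lej]]|->].
- by lia.
- by rewrite addKn => /hi; lia.
- by apply/holds_tensor; right; rewrite leq_addr addKn; split=> //; apply/hi.
Qed.

Lemma split_epi_Ell n m (R : Rel n m) : split_epi R -> split_epi (rEll R).
Proof.
move=> cR k; rewrite ltnS leq_eqVlt => /orP[/eqP ->|/cR[i hi]].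
  exists n => j; split=> [/holds_Ell[/holds_lt[]|[]]|->] //; first lia.
  by apply/holds_Ell; right.
exists i => j; split=> [/holds_Ell[/hi|[ei ->]]|->] //.
  by have /holds_lt[] := (hi k).2 erefl; lia.
by apply/holds_Ell; left; apply/hi.
Qed.

Lemma split_epi_id n m : m <= n -> split_epi (rid n m).
Proof.
move=> le k ltk; exists k => j; split=> [/holds_id[]|->] //.
by apply/holds_id; split=> //; lia.
Qed.

Lemma split_epi_symm a b : split_epi (rsymm a b).
Proof.
move=> k ltk; have [h|h] := ltnP k a.
  exists (b + k) => j; split=> [/holds_symm|->]; first by case=> -[]; lia.
  by apply/holds_symm; right; split; lia.
exists (k - a) => j; split=> [/holds_symm|->]; first by case=> -[]; lia.
by apply/holds_symm; left; split; lia.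
Qed.

Definition dom n m (R : Rel n m) i := exists j, holds R i j.

Lemma dom_lt n m (R : Rel n m) i : dom R i -> i < n.
Proof. by case=> j /holds_lt[]. Qed.

Lemma dom_tensor n m n' m' (R : Rel n m) (S : Rel n' m') i :
  dom (rtensor R S) i <-> dom S i \/ n' <= i /\ dom R (i - n').
Proof.
split=> [[j /holds_tensor[h|[lei lej h]]]|[[j h]|[lei [j h]]]].
- by left; exists j.
- by right; split=> //; exists (j - m').
- by exists j; apply/holds_tensor; left.
- by exists (m' + j); apply/holds_tensor; right; rewrite leq_addr addKn.
Qed.

Lemma dom_Ell n m (R : Rel n m) i : dom (rEll R) i <-> dom R i \/ i = n.
Proof.
split=> [[j /holds_Ell[h|[->]]]|[[j h]|->]].
- by left; exists j.
- by right.
- by exists j; apply/holds_Ell; left.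
- by exists m; apply/holds_Ell; right.
Qed.

Lemma dom_comp_total n m k (S : Rel m k) (R : Rel n m) i :
  rtotal S -> dom (rcomp S R) i <-> dom R i.
Proof.
move=> tS; split=> [[j /holds_comp[x h _]]|[x h]]; first by exists x.
have [_ /tS[j h']] := holds_lt h.
by exists j; apply/holds_comp; exists x.
Qed.

Lemma holds_comp_eps n m (R : Rel n m) i j :
  holds (rcomp R (rid n.+1 n)) i j <-> holds R i j.
Proof.
split=> [/holds_comp[x /holds_id[_ _ ->]] //|h].
apply/holds_comp; exists i => //; apply/holds_id.
by have [lti _] := holds_lt h; split=> //; lia.
Qed.

(** [holds_comp] and [holds_tensor] again, for goals in which [garr] is to stay folded. *)
Lemma holds_Comp P (A B C : obj P) (g : arr B C) (f : arr A B) i j :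
  holds (garr (g ∘ f)) i j <->
  exists2 k, holds (garr f) i k & holds (garr g) k j.
Proof. exact: holds_comp. Qed.

Lemma holds_TensorA P (A B A' B' : obj P) (f : arr A A') (g : arr B B') i j :
  holds (garr (f ⊗ g)) i j <->
  holds (garr g) i j \/
  [/\ gobj B <= i, gobj B' <= j & holds (garr f) (i - gobj B) (j - gobj B')].
Proof. exact: holds_tensor. Qed.

End RelationCalculus.

(** * Arrows to the unit and to a letter *)

Section SmallTargets.
Variable P : Type.
Implicit Types A B C D : obj P.

Fixpoint letterless (A : obj P) : Type :=
  match A with
  | Letter _ => False
  | Unit => unit
  | Tensor A B => letterless A * letterless B
  | Ell A => letterless A
  end.

Fixpoint discard (A : obj P) : letterless A -> arr A Unit :=
  match A return letterless A -> arr A Unit with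
  | Letter _ => fun v => match v with end
  | Unit => fun _ => Id _
  | Tensor A B => fun t => lunit Unit ∘ (@discard A t.1 ⊗ @discard B t.2)
  | Ell A => fun t => @discard A t ∘ eps A
  end.

Lemma letterless_uniq A (t t' : letterless A) : t = t'.
Proof.
elim: A t t' => [p||A IHA B IHB|A IHA] //=; first by move=> [] [].
by move=> [a b] [a' b']; rewrite (IHA a a') (IHB b b').
Qed.

Lemma lunit_assoc_unit :
  lunit Unit ∘ (Id Unit ⊗ lunit Unit) ∘ assoc Unit Unit (@Unit P)
  ≡ lunit Unit ∘ (lunit Unit ⊗ Id Unit).
Proof. by rewrite -CompA triangle lunit_runit. Qed.

Lemma pull_inv A B C (f : arr A B) (f' : arr B A) (x : arr B C) (y : arr A C) :
  f ∘ f' ≡ Id B -> x ∘ f ≡ y -> y ∘ f' ≡ x.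
Proof. by move=> ff <-; rewrite -CompA ff Compa1. Qed.

Lemma discard_assoc A B C (f : arr A Unit) (g : arr B Unit) (h : arr C Unit) :
  lunit Unit ∘ (f ⊗ (lunit Unit ∘ (g ⊗ h))) ∘ assoc A B C
  ≡ lunit Unit ∘ ((lunit Unit ∘ (f ⊗ g)) ⊗ h).
Proof.
rewrite -{1}(Comp1a f) TensorA_Comp. rw assoc_nat.
by rewrite lunit_assoc_unit -(CompA (lunit Unit)) -TensorA_Comp Comp1a.
Qed.

Lemma discard_pull A B (f : arr A B) (t : letterless B) :
  exists t' : letterless A, discard t ∘ f ≡ discard t'.
Proof.
elim: f t => {A B}.
- by move=> A t; exists t; rewrite Compa1.
- move=> A B C g IHg f IHf t; have [t1 e1] := IHg t; have [t2 e2] := IHf t1.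
  by exists t2; rewrite CompA e1.
- move=> A B A' B' f IHf g IHg [t1 t2]; have [t1' e1] := IHf t1.
  have [t2' e2] := IHg t2; exists (t1', t2').
  by rewrite /= -CompA -TensorA_Comp e1 e2.
- move=> A B f IHf t; have [t' e] := IHf t; exists t'.
  by rewrite /= -CompA -eps_nat CompA e.
- move=> A B C [t1 [t2 t3]]; exists ((t1, t2), t3); exact: discard_assoc.
- move=> A B C [[t1 t2] t3]; exists (t1, (t2, t3)).
  exact: pull_inv (assocVK _ _ _) (discard_assoc _ _ _).
- move=> A t; exists (tt, t); exact: lunit_nat.
- move=> A [[] t]; exists t.
  apply: pull_inv (lunitVK _) _; exact: lunit_nat.
- move=> A t; exists (t, tt); rewrite /= lunit_runit; exact: runit_nat.
- move=> A [t []]; exists t.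
  apply: pull_inv (runitVK _) _; rewrite /= lunit_runit; exact: runit_nat.
- move=> A B [t1 t2]; exists (t2, t1).
  by rewrite /= -CompA symm_nat CompA symm_unit_unit Compa1.
- by move=> A t; exists t.
- by move=> A t; exists t; rewrite /= -!CompA eps_delta Compa1.
- move=> A B [t1 t2]; exists (t1, t2).
  by rewrite /= -!CompA eps_psi TensorA_Comp.
- by move=> []; exists tt; rewrite /= Comp1a eps_psi0.
Qed.

(** [Id Unit] is the discarding arrow of [Unit]; pulled back along [f] and along
    [g], it gives the same discarding arrow of [A]. *)
Lemma to_Unit A (f g : arr A Unit) : f ≡ g.
Proof.
have [t /= e] := discard_pull f (tt : letterless Unit).
have [t' /= e'] := discard_pull g (tt : letterless Unit).
by rewrite -(Comp1a f) -(Comp1a g) e e' (letterless_uniq t t').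
Qed.

Section Focus.
Variable p : P.

(** [p] is the only letter of [A], with one occurrence. *)
Fixpoint focus (A : obj P) : Type :=
  match A with
  | Letter q => q = p
  | Unit => False
  | Tensor A B => focus A * letterless B + letterless A * focus B
  | Ell A => focus A
  end.

Fixpoint pick_letter (A : obj P) : focus A -> arr A (Letter p) :=
  match A return focus A -> arr A (Letter p) with
  | Letter q => fun e => match e in _ = r return arr (Letter q) (Letter r) with
                         | erefl => Id _ end
  | Unit => fun v => match v with end
  | Tensor A B => fun t =>
      match t with
      | inl (o, t) => runit _ ∘ (pick_letter o ⊗ discard t)
      | inr (t, o) => lunit _ ∘ (discard t ⊗ pick_letter o)
      end
  | Ell A => fun o => @pick_letter A o ∘ eps A
  end.

Lemma focus_not_letterless A : focus A -> letterless A -> False.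
Proof.
elim: A => [q||A IHA B IHB|A IHA] //=.
by move=> [[o _] [/(IHA o)]|[_ o] [_ /(IHB o)]].
Qed.

(** For [A] a letter this is uniqueness of identity proofs on [P], which cannot be
    avoided: transporting [Id (Letter p)] along a nontrivial loop at [p] would
    give a second arrow with the same relation. *)
Lemma focus_uniq A (o o' : focus A) : o = o'.
Proof.
elim: A o o' => [q||A IHA B IHB|A IHA] //=.
  by move=> *; exact: proof_irrelevance.
move=> [[a b]|[a b]] [[a' b']|[a' b']].
- by rewrite (IHA a a') (letterless_uniq b b').
- by case: (focus_not_letterless a a').
- by case: (focus_not_letterless a' a).
- by rewrite (IHB b b') (letterless_uniq a a').
Qed.

Lemma pick_assoc1 A B C X (f : arr A X) (g : arr B Unit) (h : arr C Unit) :
  runit _ ∘ (f ⊗ (lunit Unit ∘ (g ⊗ h))) ∘ assoc A B C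
  ≡ runit _ ∘ ((runit _ ∘ (f ⊗ g)) ⊗ h).
Proof.
rewrite -{1}(Comp1a f) TensorA_Comp. rw assoc_nat.
rw triangle.
by rewrite -(CompA (runit _)) -TensorA_Comp Comp1a.
Qed.

Lemma pick_assoc2 A B C X (f : arr A Unit) (g : arr B X) (h : arr C Unit) :
  lunit _ ∘ (f ⊗ (runit _ ∘ (g ⊗ h))) ∘ assoc A B C
  ≡ runit _ ∘ ((lunit _ ∘ (f ⊗ g)) ⊗ h).
Proof.
rewrite -{1}(Comp1a f) TensorA_Comp. rw assoc_nat.
rw runit_tensor.
rewrite runit_nat -(Comp1a h) TensorA_Comp Comp1a.
by rewrite CompA.
Qed.

Lemma pick_assoc3 A B C X (f : arr A Unit) (g : arr B Unit) (h : arr C X) :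
  lunit _ ∘ (f ⊗ (lunit _ ∘ (g ⊗ h))) ∘ assoc A B C
  ≡ lunit _ ∘ ((lunit _ ∘ (f ⊗ g)) ⊗ h).
Proof.
rewrite -{1}(Comp1a f) TensorA_Comp. rw assoc_nat.
rw triangle.
by rewrite -lunit_runit -(CompA (lunit _)) -TensorA_Comp Comp1a.
Qed.

Lemma pick_letter_pull A B (f : arr A B) (o : focus B) :
  exists o' : focus A, pick_letter o ∘ f ≡ pick_letter o'.
Proof.
elim: f o => {A B}.
- by move=> A t; exists t; rewrite Compa1.
- move=> A B C g IHg f IHf t; have [t1 e1] := IHg t; have [t2 e2] := IHf t1.
  by exists t2; rewrite CompA e1.
- move=> A B A' B' f IHf g IHg [[o t]|[t o]].
    have [o' eo] := IHf o; have [t' et] := discard_pull g t; exists (inl (o', t')).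
    by rewrite /= -CompA -TensorA_Comp eo et.
  have [o' eo] := IHg o; have [t' et] := discard_pull f t; exists (inr (t', o')).
  by rewrite /= -CompA -TensorA_Comp eo et.
- move=> A B f IHf t; have [t' e] := IHf t; exists t'.
  by rewrite /= -CompA -eps_nat CompA e.
- move=> A B C [[o [t2 t3]]|[t1 [[o t3]|[t2 o]]]].
  + by exists (inl (inl (o, t2), t3)); exact: pick_assoc1.
  + by exists (inl (inr (t1, o), t3)); exact: pick_assoc2.
  + by exists (inr ((t1, t2), o)); exact: pick_assoc3.
- move=> A B C [[[[o t2]|[t1 o]] t3]|[[t1 t2] o]].
  + exists (inl (o, (t2, t3))).
    exact: pull_inv (assocVK _ _ _) (pick_assoc1 _ _ _).
  + exists (inr (t1, inl (o, t3))).
    exact: pull_inv (assocVK _ _ _) (pick_assoc2 _ _ _).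
  + exists (inr (t1, inr (t2, o))).
    exact: pull_inv (assocVK _ _ _) (pick_assoc3 _ _ _).
- move=> A o; exists (inr (tt, o)); exact: lunit_nat.
- move=> A [[[] _]|[[] o]]; exists o.
  apply: pull_inv (lunitVK _) _; exact: lunit_nat.
- move=> A o; exists (inl (o, tt)); exact: runit_nat.
- move=> A [[o []]|[_ []]]; exists o.
  apply: pull_inv (runitVK _) _; exact: runit_nat.
- move=> A B [[o t]|[t o]].
    by exists (inr (t, o)); rewrite /= -CompA symm_nat CompA runit_symm.
  by exists (inl (o, t)); rewrite /= -CompA symm_nat CompA symm_unit.
- by move=> A t; exists t.
- by move=> A t; exists t; rewrite /= -!CompA eps_delta Compa1.
- move=> A B [[o t]|[t o]].
    by exists (inl (o, t)); rewrite /= -!CompA eps_psi TensorA_Comp.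
  by exists (inr (t, o)); rewrite /= -!CompA eps_psi TensorA_Comp.
- by move=> [].
Qed.

Lemma to_Letter A (f g : arr A (Letter p)) : f ≡ g.
Proof.
have [t /= e] := pick_letter_pull f (erefl : focus (Letter p)).
have [t' /= e'] := pick_letter_pull g (erefl : focus (Letter p)).
by rewrite -(Comp1a f) -(Comp1a g) e e' (focus_uniq t t').
Qed.

End Focus.
End SmallTargets.

(** * Discarding the unrelated occurrences of L *)

Section Pruning.
Variable P : Type.
Implicit Types A B C D : obj P.

(** One boolean per occurrence of [Ell], [true] to erase it. *)
Fixpoint pruning (A : obj P) : Type :=
  match A with
  | Letter _ | Unit => unit
  | Tensor A B => pruning A * pruning B
  | Ell A => bool * pruning A
  end.

Fixpoint pruned (A : obj P) : pruning A -> obj P :=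
  match A with
  | Letter p => fun _ => Letter p
  | Unit => fun _ => Unit
  | Tensor A B => fun k => Tensor (pruned k.1) (pruned k.2)
  | Ell A => fun k => if k.1 then pruned k.2 else Ell (pruned k.2)
  end.

Fixpoint prune (A : obj P) : forall k : pruning A, arr A (pruned k) :=
  match A return forall k : pruning A, arr A (pruned k) with
  | Letter p => fun _ => Id _
  | Unit => fun _ => Id _
  | Tensor A B => fun k => prune k.1 ⊗ prune k.2
  | Ell A => fun '(b, k) =>
      match b return arr (Ell A) (if b then pruned k else Ell (pruned k)) with
      | true => prune k ∘ eps A
      | false => EllA (prune k)
      end
  end.

(** An occurrence is erased by the pulled back pruning iff all its images are
    erased, so that the residual arrow has a total relation: [eps], the only
    generator that forgets an occurrence, pulls back to an erasure and leaves an
    identity. *)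
Lemma prune_pull A B (f : arr A B) (k : pruning B) :
  exists (k' : pruning A) (f' : arr (pruned k') (pruned k)),
    prune k ∘ f ≡ f' ∘ prune k' /\ rtotal (garr f').
Proof.
elim: f k => {A B}.
- by move=> A k; exists k, (Id _); rewrite Compa1 Comp1a; split=> //; apply: total_id.
- move=> A B C g IHg f IHf k; have [k1 [g' [eg tg]]] := IHg k.
  have [k2 [f' [ef tf]]] := IHf k1; exists k2, (g' ∘ f'); split; last exact: total_comp.
  by rewrite CompA eg -CompA ef CompA.
- move=> A B A' B' f IHf g IHg [k1 k2].
  have [k1' [f' [ef tf]]] := IHf k1; have [k2' [g' [eg tg]]] := IHg k2.
  exists (k1', k2'), (f' ⊗ g'); split; last exact: total_tensor.
  by rewrite /= -!TensorA_Comp ef eg.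
- move=> A B f IHf [b k]; have [k' [f' [ef tf]]] := IHf k.
  case: b.
    by exists (true, k'), f'; split=> //=; rewrite -CompA -eps_nat CompA ef CompA.
  exists (false, k'), (EllA f'); split; last exact: total_Ell.
  by rewrite /= -!EllA_Comp ef.
- move=> A B C [k1 [k2 k3]]; exists ((k1, k2), k3), (assoc _ _ _).
  by split; [exact: assoc_nat | apply: total_id; rewrite /=; lia].
- move=> A B C [[k1 k2] k3]; exists (k1, (k2, k3)), (assocV _ _ _).
  by split; [exact: assocV_nat | apply: total_id; rewrite /=; lia].
- move=> A k; exists (tt, k), (lunit _).
  by split; [exact: lunit_nat | apply: total_id; rewrite /=; lia].
- move=> A [[] k]; exists k, (lunitV _).
  by split; [exact: lunitV_nat | apply: total_id; rewrite /=; lia].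
- move=> A k; exists (k, tt), (runit _).
  by split; [exact: runit_nat | apply: total_id; rewrite /=; lia].
- move=> A [k []]; exists k, (runitV _).
  by split; [exact: runitV_nat | apply: total_id; rewrite /=; lia].
- move=> A B [k1 k2]; exists (k2, k1), (symm _ _).
  by split; [exact: symm_nat | apply: total_symm].
- move=> A k; exists (true, k), (Id _).
  by split; [rewrite Comp1a | apply: total_id].
- move=> A [b [b' k]].
  case: b; case: b'.
  + exists (true, k), (Id _); split; last exact: total_id.
    by rewrite Comp1a /= -!CompA eps_delta Compa1.
  + exists (false, k), (Id _); split; last exact: total_id.
    by rewrite Comp1a /= -!CompA eps_delta Compa1.
  + exists (false, k), (Id _); split; last exact: total_id.
    by rewrite Comp1a /= EllA_Comp -!CompA Ell_eps_delta Compa1.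
  + exists (false, k), (delta _); split; last exact: total_delta.
    exact: delta_nat.
- move=> A B [b [k1 k2]]; case: b.
    exists ((true, k1), (true, k2)), (Id _); split; last exact: total_id.
    by rewrite /= Comp1a -CompA eps_psi TensorA_Comp.
  exists ((false, k1), (false, k2)), (psi _ _); split; last exact: total_psi.
  exact: psi_nat.
- move=> [b []]; case: b.
    exists tt, (Id _); split; last exact: total_id.
    by rewrite /= -CompA eps_psi0.
  exists tt, psi0; split; last by [].
  by rewrite /= EllA_Id Comp1a Compa1.
Qed.

Fixpoint keep (A : obj P) : pruning A :=
  match A return pruning A with
  | Letter _ | Unit => tt
  | Tensor A B => (keep A, keep B)
  | Ell A => (false, keep A)
  end.

Lemma keep_retract A :
  exists u : arr (pruned (keep A)) A, u ∘ prune (keep A) ≡ Id A /\ rtotal (garr u).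
Proof.
elim: A => [p||A [u [eu tu]] B [v [ev tv]]|A [u [eu tu]]] /=.
- by exists (Id _); rewrite Comp1a; split=> //; apply: total_id.
- by exists (Id _); rewrite Comp1a; split=> //; apply: total_id.
- exists (u ⊗ v); split; last exact: total_tensor.
  by rewrite -TensorA_Comp eu ev TensorA_Id.
- exists (EllA u); split; last exact: total_Ell.
  by rewrite -EllA_Comp eu EllA_Id.
Qed.

(** [prune_pull] for the pruning of [B] that erases nothing. *)
Lemma prune_factor A B (f : arr A B) :
  exists (k : pruning A) (f' : arr (pruned k) B), f ≡ f' ∘ prune k /\ rtotal (garr f').
Proof.
have [k [f' [e t]]] := prune_pull f (keep B).
have [u [eu tu]] := keep_retract B.
exists k, (u ∘ f'); split; last exact: total_comp.
by rewrite -CompA -e CompA eu Comp1a.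
Qed.

Lemma split_epi_prune A (k : pruning A) : split_epi (garr (prune k)).
Proof.
elim: A k => [p||A IHA B IHB|A IHA] /=.
- by move=> _; apply: split_epi_id.
- by move=> _; apply: split_epi_id.
- by move=> [k1 k2]; apply: split_epi_tensor.
- move=> [[] k] /=; last exact: split_epi_Ell.
  by apply: split_epi_comp => //; apply: split_epi_id.
Qed.

(** Only the outermost occurrence of [Ell A] has number [gobj A], and it is in the
    domain iff it is not erased. *)
Lemma prune_inj A (k k' : pruning A) :
  (forall i, dom (garr (prune k)) i <-> dom (garr (prune k')) i) -> k = k'.
Proof.
have dom_eps n m (R : Rel n m) i : dom (rcomp R (rid n.+1 n)) i <-> dom R i.
  by split=> -[j /holds_comp_eps h]; exists j.
elim: A k k' => [p||A IHA B IHB|A IHA] /=.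
- by move=> [] [].
- by move=> [] [].
- move=> [k1 k2] [k1' k2'] /= e; congr (_, _).
  + apply: IHA => i; have := e (gobj B + i).
    rewrite !dom_tensor !addKn leq_addr.
    have no l : ~ dom (garr (@prune B l)) (gobj B + i) by move/dom_lt; lia.
    by have := no k2; have := no k2'; have := isT; tauto.
  + apply: IHB => i; have := e i; rewrite !dom_tensor.
    have [lti|lei] := ltnP i (gobj B); first by have : ~ false by []; tauto.
    have no l : ~ dom (garr (@prune B l)) i by move/dom_lt; lia.
    by have := no k2; have := no k2'; have := isT; tauto.
- have no l : ~ dom (garr (@prune A l)) (gobj A) by move/dom_lt; lia.
  move=> [b k] [b' k'] e.
  have eb : b = b'.
    have := e (gobj A); have := no k; have := no k'.
    by case: b b' {e} => -[] //=; rewrite ?dom_eps ?dom_Ell; tauto.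
  case: _ / eb e => e; congr (_, _); apply: IHA => i.
  have [ei|ni] := eqVneq i (gobj A).
    by rewrite ei; have := no k; have := no k'; tauto.
  have := e i; case: (b) => /=; rewrite ?dom_eps ?dom_Ell //.
  by move/eqP: ni; tauto.
Qed.

End Pruning.

(** * Arrows to L B: cuts *)

Section Cuts.
Variable P : Type.
Implicit Types A B C D : obj P.

(** At [Ell A], [None] puts this occurrence in the cut, while [Some c] erases it and
    continues with [c] inside [A]. *)
Fixpoint cut (A : obj P) : Type :=
  match A with
  | Letter _ => False
  | Unit => unit
  | Tensor A B => cut A * cut B
  | Ell A => option (cut A)
  end.

Fixpoint cobj (A : obj P) : cut A -> obj P :=
  match A return cut A -> obj P with
  | Letter _ => fun v => match v with end
  | Unit => fun _ => Unit
  | Tensor A B => fun c => Tensor (@cobj A c.1) (@cobj B c.2)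
  | Ell A => fun c => if c is Some c then @cobj A c else Ell A
  end.

(** The coalgebra structure: cofree at the cut, and monoidal above it. *)
Fixpoint coalg (A : obj P) : forall c : cut A, arr A (Ell (cobj c)) :=
  match A return forall c : cut A, arr A (Ell (cobj c)) with
  | Letter _ => fun v => match v with end
  | Unit => fun _ => psi0
  | Tensor A B => fun c => psi _ _ ∘ (@coalg A c.1 ⊗ @coalg B c.2)
  | Ell A => fun c =>
      match c return arr (Ell A) (Ell (@cobj (Ell A) c)) with
      | Some c => @coalg A c ∘ eps A
      | None => delta A
      end
  end.

Lemma coalg_assoc A B C A' B' C' (f : arr A (Ell A')) (g : arr B (Ell B'))
    (h : arr C (Ell C')) :
  (psi _ _ ∘ (f ⊗ (psi _ _ ∘ (g ⊗ h)))) ∘ assoc A B C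
  ≡ EllA (assoc A' B' C') ∘ (psi _ _ ∘ ((psi _ _ ∘ (f ⊗ g)) ⊗ h)).
Proof.
rewrite -{1}(Comp1a f) TensorA_Comp. rw assoc_nat.
rwr psi_assoc.
rwr TensorA_Comp. by rewrite Comp1a.
Qed.

Lemma coalg_inv A B A' B' (f : arr A B) (fV : arr B A) (f' : arr A' B')
    (f'V : arr B' A') (x : arr B (Ell B')) (y : arr A (Ell A')) :
  f ∘ fV ≡ Id B -> f'V ∘ f' ≡ Id A' ->
  x ∘ f ≡ EllA f' ∘ y -> y ∘ fV ≡ EllA f'V ∘ x.
Proof.
move=> e e' h; rewrite -(Compa1 x) -e CompA CompA -(CompA _ x f) h.
by rewrite CompA -EllA_Comp e' EllA_Id Comp1a.
Qed.

Lemma coalg_lunit A A' (f : arr A (Ell A')) :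
  f ∘ lunit A ≡ EllA (lunit A') ∘ (psi _ _ ∘ (psi0 ⊗ f)).
Proof.
rewrite lunit_nat -psi_lunit.
by rwr TensorA_Comp; rewrite Comp1a Compa1.
Qed.

Lemma coalg_runit A A' (f : arr A (Ell A')) :
  f ∘ runit A ≡ EllA (runit A') ∘ (psi _ _ ∘ (f ⊗ psi0)).
Proof.
rewrite runit_nat -psi_runit.
by rwr TensorA_Comp; rewrite Comp1a Compa1.
Qed.

(** Every arrow is a coalgebra morphism for suitable structures.  On the generators
    this amounts to the axioms of a symmetric monoidal comonad. *)
Lemma cut_pull A B (f : arr A B) (c : cut B) :
  exists (c' : cut A) (f' : arr (cobj c') (cobj c)),
    coalg c ∘ f ≡ EllA f' ∘ coalg c'.
Proof.
elim: f c => {A B}.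
- by move=> A c; exists c, (Id _); rewrite EllA_Id Compa1 Comp1a.
- move=> A B C g IHg f IHf c; have [c1 [g' eg]] := IHg c.
  have [c2 [f' ef]] := IHf c1; exists c2, (g' ∘ f').
  by rewrite CompA eg -CompA ef EllA_Comp CompA.
- move=> A B A' B' f IHf g IHg [c1 c2].
  have [c1' [f' ef]] := IHf c1; have [c2' [g' eg]] := IHg c2.
  exists (c1', c2'), (f' ⊗ g').
  rewrite /= CompA psi_nat -!CompA -!TensorA_Comp. by rewrite ef eg.
- move=> A B f IHf [c|]; last by exists None, (EllA f); rewrite /= delta_nat.
  have [c' [f' ef]] := IHf c; exists (Some c'), f'.
  by rewrite /= -CompA -eps_nat CompA ef CompA.
- move=> A B C [c1 [c2 c3]]; exists ((c1, c2), c3), (assoc _ _ _).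
  exact: coalg_assoc.
- move=> A B C [[c1 c2] c3]; exists (c1, (c2, c3)), (assocV _ _ _).
  exact: coalg_inv (assocVK _ _ _) (assocK _ _ _) (coalg_assoc _ _ _).
- move=> A c; exists (tt, c), (lunit _); exact: coalg_lunit.
- move=> A [[] c]; exists c, (lunitV _).
  exact: coalg_inv (lunitVK _) (lunitK _) (coalg_lunit _).
- move=> A c; exists (c, tt), (runit _); exact: coalg_runit.
- move=> A [c []]; exists c, (runitV _).
  exact: coalg_inv (runitVK _) (runitK _) (coalg_runit _).
- move=> A B [c1 c2]; exists (c2, c1), (symm _ _).
  by rewrite /= CompA psi_symm -!CompA symm_nat.
- by move=> A c; exists (Some c), (Id _); rewrite EllA_Id Comp1a.
- move=> A [[c|]|].
  + exists (Some c), (Id _).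
    by rewrite EllA_Id Comp1a /= -!CompA eps_delta Compa1.
  + exists None, (Id _).
    by rewrite EllA_Id Comp1a /= -!CompA eps_delta Compa1.
  + by exists None, (delta A); rewrite /= deltaA.
- move=> A B [[c1 c2]|].
    exists (Some c1, Some c2), (Id _).
    by rewrite EllA_Id Comp1a /= -!CompA eps_psi TensorA_Comp.
  by exists (None, None), (psi A B); rewrite /= delta_psi CompA.
- move=> [[]|].
    by exists tt, (Id _); rewrite EllA_Id Comp1a /= -CompA eps_psi0 Compa1.
  by exists tt, psi0; exact: delta_psi0.
Qed.

(** The cut at the outermost [L] of [Ell B] has coalgebra [delta B], which
    [EllA (eps B)] cancels. *)
Lemma cut_factor A B (f : arr A (Ell B)) :
  exists (c : cut A) (f' : arr (cobj c) B), f ≡ EllA f' ∘ coalg c.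
Proof.
have [c [f' /= e]] := cut_pull f (None : cut (Ell B)).
exists c, (eps B ∘ f'); rewrite EllA_Comp -CompA -e CompA.
by rewrite Ell_eps_delta Comp1a.
Qed.

(** The counit removes the extra outermost [L] of the target. *)
Lemma split_epi_coalg A (c : cut A) : split_epi (garr (eps _ ∘ coalg c)).
Proof.
elim: A c => [p||A IHA B IHB|A IHA] //.
- move=> [c1 c2].
  have e : eps _ ∘ coalg ((c1, c2) : cut (A ⊗ B)) ≡
    (eps _ ∘ coalg c1) ⊗ (eps _ ∘ coalg c2).
    by rewrite /= CompA eps_psi TensorA_Comp.
  by rewrite (garr_eqarr e); apply: split_epi_tensor.
- move=> [c|]; last by rewrite (garr_eqarr (eps_delta _)); apply: split_epi_id.
  rewrite (garr_eqarr (CompA _ _ _)).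
  by apply: split_epi_comp; [apply: IHA | apply: split_epi_id].
Qed.

(** What is related to the outermost [L] of the target of [psi] is what is related to
    one of the two outermost [L]s of its source. *)
Lemma holds_top_psi A B A' B' (f : arr A (Ell A')) (g : arr B (Ell B')) i :
  holds (garr (psi _ _ ∘ (f ⊗ g))) i (gobj A' + gobj B') <->
  holds (garr g) i (gobj B') \/
  gobj B <= i /\ holds (garr f) (i - gobj B) (gobj A').
Proof.
split=> [/holds_comp[x /= h /holds_psi hx]|h].
  case: hx => -[]; try lia.
    move=> ex _; move: h; rewrite ex => /holds_tensor[|[]]; first by left.
    lia.
  move=> ex _; move: h; rewrite ex => /holds_tensor[/holds_lt[]|[lei _ h]].
    rewrite /=; lia.
  by right; split=> //; move: h; rewrite /= subSS addnK.
case: h => [h|[lei h]]; apply/holds_comp => /=.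
  exists (gobj B'); first by apply/holds_tensor; left.
  by apply/holds_psi; constructor 2.
exists (gobj A' + gobj B').+1; last by apply/holds_psi; constructor 4.
by apply/holds_tensor; right; split=> //=; [lia | rewrite subSS addnK].
Qed.

(** The outermost occurrence of [Ell A] has number [gobj A], and it is related to the
    outermost [L] of the target iff it is in the cut. *)
Lemma cut_inj A (c c' : cut A) :
  (forall i, holds (garr (coalg c)) i (gobj (cobj c)) <->
             holds (garr (coalg c')) i (gobj (cobj c'))) -> c = c'.
Proof.
elim: A c c' => [p||A IHA B IHB|A IHA] //.
- by move=> [] [].
- move=> [c1 c2] [c1' c2'] e; congr (_, _).
  + apply: IHA => i; have := e (gobj B + i).
    have no (l : cut B) x : ~ holds (garr (coalg l)) (gobj B + i) x.
      by move/holds_lt; lia.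
    rewrite !holds_top_psi !addKn leq_addr /=.
    have := no c2 (gobj (cobj c2)); have := no c2' (gobj (cobj c2')).
    by have := isT; tauto.
  + apply: IHB => i; have := e i; rewrite !holds_top_psi.
    have [lti|lei] := ltnP i (gobj B); first by have : ~ false by []; tauto.
    have no (l : cut B) x : ~ holds (garr (coalg l)) i x.
      by move/holds_lt; lia.
    have := no c2 (gobj (cobj c2)); have := no c2' (gobj (cobj c2')).
    by tauto.
- have here : holds (rdelta (gobj A)) (gobj A) (gobj A).+1.
    by apply/holds_delta; right.
  have skip (c : cut A) x : ~ holds (garr (coalg c ∘ eps A)) (gobj A) x.
    by move=> /holds_comp_eps/holds_lt[]; rewrite ltnn.
  move=> [c|] [c'|] e //.
  + congr Some; apply: IHA => i; have := e i.
    by rewrite /= !holds_comp_eps.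
  + by case: (skip c (gobj (cobj c))); apply/(e (gobj A)).
  + by case: (skip c' (gobj (cobj c'))); apply/(e (gobj A)).
Qed.

(** The relation of an arrow to [Ell B] thus determines the cut in its normal form. *)
Lemma holds_Ell_top A B C (f : arr B C) (x : arr A (Ell B)) i :
  holds (garr (EllA f ∘ x)) i (gobj C) <-> holds (garr x) i (gobj B).
Proof.
split=> [/holds_comp[y h /holds_Ell[/holds_lt[_]|[ey _]]]|h].
- by rewrite ltnn.
- by move: h; rewrite ey.
- by apply/holds_comp; exists (gobj B) => //; apply/holds_Ell; right.
Qed.

Lemma Ell_step A B (f g : arr A (Ell B)) :
  (forall A' (f' g' : arr A' B), garr f' = garr g' -> f' ≡ g') ->
  garr f = garr g -> f ≡ g.
Proof.
move=> IH efg; have [c [f' ef]] := cut_factor f; have [c' [g' eg]] := cut_factor g.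
have ec : c = c'.
  apply: cut_inj => i.
  by rewrite -!(holds_Ell_top f') -(garr_eqarr ef) efg (garr_eqarr eg) !holds_Ell_top.
case: _ / ec g' eg => g' eg; rewrite ef eg; suff -> : f' ≡ g' by [].
apply: IH; apply: (split_epi_cancel (split_epi_coalg (c := c))).
have h (x : arr (cobj c) B) : eps B ∘ (EllA x ∘ coalg c) ≡ x ∘ (eps _ ∘ coalg c).
  by rewrite CompA -eps_nat CompA.
rewrite -[LHS]/(garr (f' ∘ (eps _ ∘ coalg c))) -[RHS]/(garr (g' ∘ (eps _ ∘ coalg c))).
rewrite -!(garr_eqarr (h _)).
rewrite /= -/(garr (EllA f' ∘ coalg c)) -/(garr (EllA g' ∘ coalg c)).
by rewrite -(garr_eqarr ef) efg (garr_eqarr eg).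
Qed.

End Cuts.

(** * Arrows to a tensor product: splittings *)

Section Splittings.
Variable P : Type.
Implicit Types A B C D : obj P.

(** [true] stands for the left factor.  At [Ell A], [inl c] puts the whole expression on
    side [c], while [inr s] erases this [L] and continues with [s] inside [A]. *)
Fixpoint splitting (A : obj P) : Type :=
  match A with
  | Letter _ => bool
  | Unit => unit
  | Tensor A B => splitting A * splitting B
  | Ell A => bool + splitting A
  end.

Definition on_side (b c : bool) A := if eqb b c then A else Unit.

Definition place (c : bool) A : arr A (on_side true c A ⊗ on_side false c A) :=
  match c with
  | true => runitV A
  | false => lunitV A
  end.
Arguments place : simpl never.

Fixpoint sobj (b : bool) (A : obj P) : splitting A -> obj P :=
  match A return splitting A -> obj P with
  | Letter p => fun c => on_side b c (Letter p)
  | Unit => fun _ => Unit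
  | Tensor A B => fun s => Tensor (@sobj b A s.1) (@sobj b B s.2)
  | Ell A => fun s =>
      match s with
      | inl c => on_side b c (Ell A)
      | inr s => @sobj b A s
      end
  end.

Fixpoint sarr (A : obj P) :
    forall s : splitting A, arr A (sobj true s ⊗ sobj false s) :=
  match A return forall s : splitting A, arr A (sobj true s ⊗ sobj false s) with
  | Letter p => fun c => place c (Letter p)
  | Unit => fun _ => lunitV Unit
  | Tensor A B => fun s => mid _ _ _ _ ∘ (@sarr A s.1 ⊗ @sarr B s.2)
  | Ell A => fun s =>
      match s return arr (Ell A) (@sobj true (Ell A) s ⊗ @sobj false (Ell A) s) with
      | inl c => place c (Ell A)
      | inr s => @sarr A s ∘ eps A
      end
  end.

Definition on_side_arr b c A B (f : arr A B) : arr (on_side b c A) (on_side b c B) :=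
  match eqb b c as d return arr (if d then A else Unit) (if d then B else Unit) with
  | true => f
  | false => Id Unit
  end.

Lemma place_nat c A B (f : arr A B) :
  place c B ∘ f ≡ (on_side_arr true c f ⊗ on_side_arr false c f) ∘ place c A.
Proof. by case: c => /=; rewrite ?runitV_nat ?lunitV_nat. Qed.

Lemma mid_runitV A B :
  (Id (A ⊗ B) ⊗ lunit Unit) ∘ mid A Unit B Unit ∘ (runitV A ⊗ runitV B)
  ≡ runitV (A ⊗ B).
Proof.
apply: (comp_cancel_l (runitK _)).
by rewrite !CompA mid_unit_right runitVK -TensorA_Comp !runitVK TensorA_Id.
Qed.

Lemma mid_lunitV A B :
  (lunit Unit ⊗ Id (A ⊗ B)) ∘ mid Unit A Unit B ∘ (lunitV A ⊗ lunitV B)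
  ≡ lunitV (A ⊗ B).
Proof.
apply: (comp_cancel_l (lunitK _)).
by rewrite !CompA mid_unit_left lunitVK -TensorA_Comp !lunitVK TensorA_Id.
Qed.

(** Putting both factors on one side amounts to putting the tensor product there; the
    other side then receives [Unit ⊗ Unit], which is collapsed. *)
Lemma place_mid c A B C (f : arr (A ⊗ B) C) :
  exists h1 h2,
    place c C ∘ f ≡ (h1 ⊗ h2) ∘ (mid _ _ _ _ ∘ (place c A ⊗ place c B)).
Proof.
case: c.
  exists f, (lunit Unit).
  by rewrite tensor_lr -runitV_nat -mid_runitV !CompA.
exists (lunit Unit), f.
by rewrite tensor_rl -lunitV_nat -mid_lunitV !CompA.
Qed.

Lemma split_assoc A B C A1 A2 B1 B2 C1 C2 (f : arr A (A1 ⊗ A2))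
    (g : arr B (B1 ⊗ B2)) (h : arr C (C1 ⊗ C2)) :
  (mid _ _ _ _ ∘ (f ⊗ (mid _ _ _ _ ∘ (g ⊗ h)))) ∘ assoc A B C
  ≡ (assoc A1 B1 C1 ⊗ assoc A2 B2 C2)
    ∘ (mid _ _ _ _ ∘ ((mid _ _ _ _ ∘ (f ⊗ g)) ⊗ h)).
Proof.
rewrite -{1}(Comp1a f) TensorA_Comp. rw assoc_nat.
rwr mid_assoc.
rwr TensorA_Comp. by rewrite Comp1a.
Qed.

Lemma split_inv A B A1 A2 B1 B2 (f : arr A B) (fV : arr B A) (f1 : arr A1 B1)
    (f1V : arr B1 A1) (f2 : arr A2 B2) (f2V : arr B2 A2)
    (x : arr B (B1 ⊗ B2)) (y : arr A (A1 ⊗ A2)) :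
  f ∘ fV ≡ Id B -> f1V ∘ f1 ≡ Id A1 -> f2V ∘ f2 ≡ Id A2 ->
  x ∘ f ≡ (f1 ⊗ f2) ∘ y -> y ∘ fV ≡ (f1V ⊗ f2V) ∘ x.
Proof.
move=> e e1 e2 h; rewrite -(Compa1 x) -e CompA CompA -(CompA _ x f) h.
by rewrite CompA -TensorA_Comp e1 e2 TensorA_Id Comp1a.
Qed.

Lemma split_lunit A A1 A2 (f : arr A (A1 ⊗ A2)) :
  f ∘ lunit A ≡ (lunit A1 ⊗ lunit A2) ∘ (mid _ _ _ _ ∘ (lunitV Unit ⊗ f)).
Proof.
rewrite lunit_nat -mid_lunit.
by rwr TensorA_Comp; rewrite Comp1a Compa1.
Qed.

Lemma split_runit A A1 A2 (f : arr A (A1 ⊗ A2)) :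
  f ∘ runit A ≡ (runit A1 ⊗ runit A2) ∘ (mid _ _ _ _ ∘ (f ⊗ lunitV Unit)).
Proof.
rewrite runit_nat -mid_runit.
by rwr TensorA_Comp; rewrite Comp1a Compa1.
Qed.

(** Symmetric monoidal functoriality of the tensor product, expressed by the
    coherence equations of [mid], settles the symmetric monoidal generators. *)
Lemma split_pull A B (f : arr A B) (s : splitting B) :
  exists (s' : splitting A) (f1 : arr (sobj true s') (sobj true s))
         (f2 : arr (sobj false s') (sobj false s)),
    sarr s ∘ f ≡ (f1 ⊗ f2) ∘ sarr s'.
Proof.
elim: f s => {A B}.
- by move=> A s; exists s, (Id _), (Id _); rewrite TensorA_Id Compa1 Comp1a.
- move=> A B C g IHg f IHf s; have [s1 [g1 [g2 eg]]] := IHg s.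
  have [s2 [f1 [f2 ef]]] := IHf s1; exists s2, (g1 ∘ f1), (g2 ∘ f2).
  by rewrite CompA eg -CompA ef TensorA_Comp CompA.
- move=> A B A' B' f IHf g IHg [s1 s2].
  have [s1' [f1 [f2 ef]]] := IHf s1; have [s2' [g1 [g2 eg]]] := IHg s2.
  exists (s1', s2'), (f1 ⊗ g1), (f2 ⊗ g2).
  by rewrite /= CompA mid_nat -!CompA -!TensorA_Comp ef eg.
- move=> A B f IHf [c|s].
    exists (inl c), (on_side_arr true c (EllA f)), (on_side_arr false c (EllA f)).
    exact: place_nat.
  have [s' [f1 [f2 ef]]] := IHf s; exists (inr s'), f1, f2.
  by rewrite /= -CompA -eps_nat CompA ef CompA.
- move=> A B C [s1 [s2 s3]]; exists ((s1, s2), s3), (assoc _ _ _), (assoc _ _ _).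
  exact: split_assoc.
- move=> A B C [[s1 s2] s3]; exists (s1, (s2, s3)), (assocV _ _ _), (assocV _ _ _).
  exact: split_inv (assocVK _ _ _) (assocK _ _ _) (assocK _ _ _) (split_assoc _ _ _).
- move=> A s; exists (tt, s), (lunit _), (lunit _); exact: split_lunit.
- move=> A [[] s]; exists s, (lunitV _), (lunitV _).
  exact: split_inv (lunitVK _) (lunitK _) (lunitK _) (split_lunit _).
- move=> A s; exists (s, tt), (runit _), (runit _); exact: split_runit.
- move=> A [s []]; exists s, (runitV _), (runitV _).
  exact: split_inv (runitVK _) (runitK _) (runitK _) (split_runit _).
- move=> A B [s1 s2]; exists (s2, s1), (symm _ _), (symm _ _).
  by rewrite /= CompA mid_symm -!CompA symm_nat.
- by move=> A s; exists (inr s), (Id _), (Id _); rewrite TensorA_Id Comp1a.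
- move=> A [c|[c|s]].
  + exists (inl c), (on_side_arr true c (delta A)), (on_side_arr false c (delta A)).
    exact: place_nat.
  + exists (inl c), (Id _), (Id _).
    by rewrite TensorA_Id Comp1a /= -!CompA eps_delta Compa1.
  + exists (inr s), (Id _), (Id _).
    by rewrite TensorA_Id Comp1a /= -!CompA eps_delta Compa1.
- move=> A B [c|[s1 s2]].
    have [h1 [h2 e]] := place_mid c (psi A B).
    by exists (inl c, inl c), h1, h2.
  exists (inr s1, inr s2), (Id _), (Id _).
  by rewrite TensorA_Id Comp1a /= -!CompA eps_psi TensorA_Comp.
- move=> [c|[]].
    exists tt; case: c.
      by exists psi0, (Id _); rewrite /= -runitV_lunitV runitV_nat.
    by exists (Id _), psi0; rewrite /= lunitV_nat.
  by exists tt, (Id _), (Id _); rewrite TensorA_Id Comp1a /= -CompA eps_psi0 Compa1.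
Qed.

Fixpoint all_on (c : bool) (A : obj P) : splitting A :=
  match A return splitting A with
  | Letter _ => c
  | Unit => tt
  | Tensor A B => (all_on c A, all_on c B)
  | Ell A => inl c
  end.

(** Splitting off an empty right factor is invertible.  The residual object on the left
    is [A], but only up to a recursively built arrow. *)
Lemma all_left A : exists (u : arr (sobj true (all_on true A)) A)
    (v : arr (sobj false (all_on true A)) Unit),
  (u ⊗ v) ∘ sarr (all_on true A) ≡ runitV A.
Proof.
elim: A => [p||A [u [v e]] B [u' [v' e']]|A _].
- by exists (Id _), (Id _); rewrite TensorA_Id Comp1a.
- by exists (Id _), (Id _); rewrite TensorA_Id Comp1a runitV_lunitV.
- exists (u ⊗ u'), (lunit Unit ∘ (v ⊗ v')).
  rewrite -{1}(Comp1a (u ⊗ u')) TensorA_Comp /=.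
  rw mid_nat. rwr TensorA_Comp. rewrite e e'.
  exact: mid_runitV.
- by exists (Id _), (Id _); rewrite TensorA_Id Comp1a.
Qed.

Lemma all_right A : exists (u : arr (sobj true (all_on false A)) Unit)
    (v : arr (sobj false (all_on false A)) A),
  (u ⊗ v) ∘ sarr (all_on false A) ≡ lunitV A.
Proof.
elim: A => [p||A [u [v e]] B [u' [v' e']]|A _].
- by exists (Id _), (Id _); rewrite TensorA_Id Comp1a.
- by exists (Id _), (Id _); rewrite TensorA_Id Comp1a.
- exists (lunit Unit ∘ (u ⊗ u')), (v ⊗ v').
  rewrite -{1}(Comp1a (v ⊗ v')) TensorA_Comp /=.
  rw mid_nat. rwr TensorA_Comp. rewrite e e'.
  exact: mid_lunitV.
- by exists (Id _), (Id _); rewrite TensorA_Id Comp1a.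
Qed.

(** [B1 ⊗ B2] is split into [B1] and [B2], which is invertible. *)
Lemma split_factor A B1 B2 (f : arr A (B1 ⊗ B2)) :
  exists (s : splitting A) (f1 : arr (sobj true s) B1) (f2 : arr (sobj false s) B2),
    f ≡ (f1 ⊗ f2) ∘ sarr s.
Proof.
have [s [f1 [f2 e]]] :=
  split_pull f ((all_on true B1, all_on false B2) : splitting (B1 ⊗ B2)).
have [u [v el]] := all_left B1; have [u' [v' er]] := all_right B2.
exists s, ((runit B1 ∘ (u ⊗ u')) ∘ f1), ((lunit B2 ∘ (v ⊗ v')) ∘ f2).
rewrite 2!TensorA_Comp -!CompA -e /= !CompA.
rw mid_nat. rwr TensorA_Comp. rewrite el er mid_unit.
by rewrite Compa1 -TensorA_Comp runitVK lunitVK TensorA_Id Comp1a.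
Qed.


Lemma split_epi_mid A A' B B' : split_epi (garr (mid A A' B B')).
Proof.
rewrite !(garr_eqarr (midE _ _ _ _)) /= (garr_eqarr (swapE _ _ _)) /=.
do ?[apply: split_epi_comp | apply: split_epi_tensor | apply: split_epi_symm].
all: by apply: split_epi_id => /=; lia.
Qed.

Lemma total_mid A A' B B' : rtotal (garr (mid A A' B B')).
Proof.
rewrite !(garr_eqarr (midE _ _ _ _)) /= (garr_eqarr (swapE _ _ _)) /=.
do ?[apply: total_comp | apply: total_tensor | apply: total_symm].
all: by apply: total_id => /=; lia.
Qed.

(** From right to left, the source consists of the blocks [B'], [B], [A'], [A], of which
    [B] and [A] go to the left factor [A ⊗ B] of the target. *)
Lemma holds_mid A A' B B' i j : holds (garr (mid A A' B B')) i j ->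
  (gobj A' + gobj B' <= j) =
  (gobj B' <= i < gobj B' + gobj B) || (gobj B' + gobj B + gobj A' <= i).
Proof.
rewrite (garr_eqarr (midE _ _ _ _)) /= (garr_eqarr (swapE _ _ _)) /=.
move/holds_wp; repeat wp_hyp; lia.
Qed.

Lemma split_epi_sarr A (s : splitting A) : split_epi (garr (sarr s)).
Proof.
have split_epi_place c B : split_epi (garr (place c B)).
  by case: c; apply: split_epi_id; rewrite /= ?addn0.
elim: A s => [p||A IHA B IHB|A IHA].
- by move=> c; apply: split_epi_place.
- by move=> s; apply: split_epi_id.
- move=> [s1 s2]; apply: split_epi_comp; first exact: split_epi_mid.
  by apply: split_epi_tensor; [apply: IHA | apply: IHB].
- move=> [c|s]; first exact: split_epi_place.
  by apply: split_epi_comp; [apply: IHA | apply: split_epi_id].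
Qed.

Fixpoint side (A : obj P) : splitting A -> nat -> option bool :=
  match A return splitting A -> nat -> option bool with
  | Letter _ => fun c i => if i < 1 then Some c else None
  | Unit => fun _ _ => None
  | Tensor A B => fun s i =>
      if i < gobj B then @side B s.2 i else @side A s.1 (i - gobj B)
  | Ell A => fun s i =>
      match s with
      | inl c => if i < (gobj A).+1 then Some c else None
      | inr s => @side A s i
      end
  end.

(** [c] tells on which side of [B ⊗ C] the occurrence [i] has an image: the elements
    from [gobj C] on are those of the left factor [B]. *)
Definition sends A B C (f : arr A (B ⊗ C)) i c :=
  exists2 j, holds (garr f) i j & (gobj C <= j) = c.

Lemma sends_place c A i d :
  sends (place c A) i d <-> (if i < gobj A then Some c else None) = Some d.
Proof.
case: c; (split=> [[j /holds_id[h1 _ <-] <-]|]).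
- by rewrite h1.
- by case: ltnP => // h [<-]; exists i => //; apply/holds_id => /=; rewrite addn0.
- by rewrite h1; congr Some; apply/esym/negbTE; rewrite -ltnNge.
- case: ltnP => // h [<-]; exists i; first exact/holds_id.
  by apply/negbTE; rewrite -ltnNge.
Qed.

Lemma sends_mid A B A1 A2 B1 B2 (f : arr A (A1 ⊗ A2)) (g : arr B (B1 ⊗ B2)) i c :
  sends (mid _ _ _ _ ∘ (f ⊗ g)) i c <->
  if i < gobj B then sends g i c else sends f (i - gobj B) c.
Proof.
split.
  move=> [j /holds_Comp[x h /holds_mid /= ->] <-].
  have [lti|lei] := ltnP i (gobj B).
    case/holds_TensorA: h => [h|[]]; last lia.
    by exists x => //; have [_ /= ?] := holds_lt h; lia.
  case/holds_TensorA: h => [/holds_lt|[/= _ ? h]]; first lia.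
  by eexists; [exact: h | lia].
have main x : holds (garr (f ⊗ g)) i x ->
    (gobj B2 <= x < gobj B2 + gobj B1) || (gobj B2 + gobj B1 + gobj A2 <= x) = c ->
    sends (mid _ _ _ _ ∘ (f ⊗ g)) i c.
  move=> h <-; have [_ /total_mid[j h']] := holds_lt h.
  by exists j; [apply/holds_Comp; exists x | exact: (holds_mid h')].
have [lti|lei] := ltnP i (gobj B) => -[x h e].
  apply: (main x); first by apply/holds_TensorA; left.
  by have [_ /= ?] := holds_lt h; lia.
apply: (main (gobj B1 + gobj B2 + x)).
  by apply/holds_TensorA; right; rewrite /= leq_addr addKn.
by rewrite -e; lia.
Qed.

Lemma sends_sarr A (s : splitting A) i c : sends (sarr s) i c <-> side s i = Some c.
Proof.
elim: A s i => [p||A IHA B IHB|A IHA].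
- by move=> b i; apply: sends_place.
- by move=> s i; split=> // -[j /holds_lt[]].
- move=> [s1 s2] i; rewrite [X in X <-> _]sends_mid /=.
  by case: ifP => _; [apply: IHB | apply: IHA].
- move=> [b|s] i; first exact: sends_place.
  rewrite -IHA; split=> -[j h e]; exists j => //; exact/holds_comp_eps.
Qed.

(** At [Ell A], whether the outermost occurrence, number [gobj A], has a side tells
    [inl] from [inr]. *)
Lemma side_inj A (s s' : splitting A) : side s =1 side s' -> s = s'.
Proof.
have big B (t : splitting B) : side t (gobj B) = None.
  case e: side => [c|] //; move/sends_sarr: e => [j /holds_lt[]].
  by rewrite ltnn.
elim: A s s' => [p||A IHA B IHB|A IHA].
- by move=> c c' /(_ 0) [].
- by move=> [] [].
- move=> [s1 s2] [s1' s2'] e; congr (_, _).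
    by apply: IHA => i; have := e (gobj B + i); rewrite /= addKn ltnNge leq_addr.
  apply: IHB => i; have := e i; rewrite /=; case: ltnP => // lei _.
  have out (t : splitting B) : side t i = None.
    case e': side => [c|] //; move/sends_sarr: e' => [j /holds_lt[]]; lia.
  by rewrite !out.
- move=> [c|s] [c'|s'] e.
  + by have := e 0 => /= -[->].
  + by have := e (gobj A); rewrite /= ltnSn big.
  + by have := e (gobj A); rewrite /= ltnSn big.
  + by congr inr; apply: IHA.
Qed.

Lemma sends_tensor A B1 B2 C1 C2 (f : arr B1 C1) (g : arr B2 C2)
    (x : arr A (B1 ⊗ B2)) i c :
  sends ((f ⊗ g) ∘ x) i c -> sends x i c.
Proof.
move=> [j /holds_Comp[y h /holds_TensorA h'] <-]; exists y => //.
by case: h' => [/holds_lt|[]]; lia.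
Qed.

Lemma rtensor_inj n m n' m' (R R' : Rel n m) (S S' : Rel n' m') :
  rtensor R S = rtensor R' S' -> R = R' /\ S = S'.
Proof.
suff main (R1 R2 : Rel n m) (S1 S2 : Rel n' m') i j :
    rtensor R1 S1 = rtensor R2 S2 ->
    (holds R1 i j -> holds R2 i j) /\ (holds S1 i j -> holds S2 i j).
  by move=> e; split; apply: holds_eq => i j;
    have [? ?] := main _ _ _ _ i j e; have [? ?] := main _ _ _ _ i j (esym e).
move=> e; split=> h.
  have : holds (rtensor R1 S1) (n' + i) (m' + j).
    by apply/holds_tensor; right; rewrite !addKn !leq_addr.
  rewrite e => /holds_tensor[/holds_lt|[_ _]]; first lia.
  by rewrite !addKn.
have : holds (rtensor R1 S1) i j by apply/holds_tensor; left.
by rewrite e => /holds_tensor[//|[]]; have := holds_lt h; lia.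
Qed.

(** Totality of [garr f] makes every occurrence in [A] have an image on some side, and
    this is its side in the splittings of both [f] and [g]. *)
Lemma Tensor_step_total A B1 B2 (f g : arr A (B1 ⊗ B2)) :
  (forall A' (f' g' : arr A' B1), garr f' = garr g' -> f' ≡ g') ->
  (forall A' (f' g' : arr A' B2), garr f' = garr g' -> f' ≡ g') ->
  rtotal (garr f) -> garr f = garr g -> f ≡ g.
Proof.
move=> IH1 IH2 tf efg.
have [s [f1 [f2 ef]]] := split_factor f; have [s' [g1 [g2 eg]]] := split_factor g.
have es : s = s'.
  apply: side_inj => i; have [lti|lei] := ltnP i (gobj A).
    have [j h] := tf i lti.
    have hs : sends (sarr s) i (gobj B2 <= j).
      by apply: (@sends_tensor _ _ _ _ _ f1 f2); exists j; rewrite // -(garr_eqarr ef).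
    have hs' : sends (sarr s') i (gobj B2 <= j).
      apply: (@sends_tensor _ _ _ _ _ g1 g2); exists j => //.
      by rewrite -(garr_eqarr eg) -efg.
    by move/sends_sarr: hs => ->; move/sends_sarr: hs' => ->.
  have out (t : splitting A) : side t i = None.
    case e': side => [c|] //; move/sends_sarr: e' => [j /holds_lt[]]; lia.
  by rewrite !out.
case: _ / es g1 g2 eg => g1 g2 eg.
have [] := @rtensor_inj _ _ _ _ (garr f1) (garr g1) (garr f2) (garr g2).
  apply: (split_epi_cancel (split_epi_sarr (s := s))).
  by rewrite -[LHS](garr_eqarr ef) -[RHS](garr_eqarr eg).
by move=> /IH1 e1 /IH2 e2; rewrite ef eg e1 e2.
Qed.

End Splittings.

(** * Faithfulness *)

(** Both arrows erase the occurrences outside the domain of their common relation,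
    which reduces the claim to total relations. *)
Lemma Tensor_step P (A B1 B2 : obj P) (f g : arr A (B1 ⊗ B2)) :
  (forall A' (f' g' : arr A' B1), garr f' = garr g' -> f' ≡ g') ->
  (forall A' (f' g' : arr A' B2), garr f' = garr g' -> f' ≡ g') ->
  garr f = garr g -> f ≡ g.
Proof.
move=> IH1 IH2 efg.
have [k [f' [ef tf]]] := prune_factor f.
have [k' [g' [eg tg]]] := prune_factor g.
have ek : k = k'.
  apply: prune_inj => i.
  rewrite -(dom_comp_total (garr (prune k)) i tf).
  rewrite -(dom_comp_total (garr (prune k')) i tg).
  rewrite -[rcomp (garr f') _](garr_eqarr ef).
  by rewrite -[rcomp (garr g') _](garr_eqarr eg) efg.
case: _ / ek g' eg tg => g' eg _; rewrite ef eg.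
suff -> : f' ≡ g' by [].
apply: Tensor_step_total => //; apply: (split_epi_cancel (split_epi_prune (k := k))).
by rewrite -[LHS](garr_eqarr ef) -[RHS](garr_eqarr eg).
Qed.

Theorem mainTheorem9 (P : Type) (A B : obj P) (f g : arr A B) :
  garr f = garr g -> f ≡ g.
Proof.
elim: B A f g => [p||B1 IH1 B2 IH2|B IH] A f g e.
- exact: to_Letter.
- exact: to_Unit.
- exact: Tensor_step.
- exact: Ell_step.
Qed.
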